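(* Let $p=r^a$ and $q=s^b$ ($a,b\ge1$) be powers of distinct primes $r,s>3$, and set $\alpha:=\lceil r^{a-2}\rceil$, $\beta:=\lceil s^{b-2}\rceil$. Let $m,n$ be odd integers with $1\le m\le p-1$, $1\le n\le q-1$, and let $\rho_{m,n}$ be the representation of $\mathrm{SL}_2(\mathbb{Z})$ associated to the irreducible $V(p,q)$-module $L_{m,n}$. Then $\rho_{m,n}$ is noncongruence so long as the inequalities $$\alpha\le m\le p-4,\qquad \beta\le n\le q-4$$ hold and at least one of $\alpha<m$, $\beta<n$ holds.
   Context: Minimal models. For coprime integers $p,q\ge 2$, $V(p,q)$ is the (simple, rational) Virasoro minimal model vertex operator algebra of central charge $\mathbf{c}=1-\frac{6(p-q)^2}{pq}$. Its irreducible modules are the $L_{m,n}$ ($0<m<p$, $0<n<q$), where $L_{m,n}$ has conformal weight $h_{m,n}=\frac{(np-mq)^2-(p-q)^2}{4pq}$; one has $L_{m,n}=L_{p-m,q-n}$, and there are no other coincidences. Standing convention: $p,m,n$ are odd. Admissible triples. For fixed $(m,n)$, a triple $\{(m,n),(m_j,n_j),(m_j,n_j)\}$ is admissible iff $0<m,m_j<p$, $0<n,n_j<q$, $m<2m_j$, $n<2n_j$, $m+2m_j<2p$, $n+2n_j<2q$, and $m+2m_j$, $n+2n_j$ are odd. It is identified with (equivalent to) $\{(m,n),(p-m_j,q-n_j),(p-m_j,q-n_j)\}$. Let $\{(m,n),(m_j,n_j),(m_j,n_j)\}$, $1\le j\le d$, be a complete list of inequivalent ones. For each $j$ the space of intertwining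 operators of type $\binom{L_{m_j,n_j}}{L_{m,n}\ L_{m_j,n_j}}$ is one-dimensional; fix a nonzero element $\mathcal{Y}_j$. 1-point functions. For homogeneous $u\in L_{m,n}$ of $L(0)$-weight $\mathrm{wt}\,u$, write $\mathcal{Y}_j(u,z)=\sum_r u(r)z^{-r-1}$, $o(u)=u(\mathrm{wt}\,u-1)$ (extended linearly), and $S_j(u,\tau)=\mathrm{tr}|_{L_{m_j,n_j}}o(u)q^{L(0)-\mathbf{c}/24}$, with $q=e^{2\pi i\tau}$ in the $q$-expansion and $\tau\in\mathbb{H}$. The representation. Let $\Gamma=\mathrm{SL}_2(\mathbb{Z})$. For real $k$ let $\upsilon_k$ be the multiplier system of weight $k$ according to which $\eta^{2k}$ transforms ($\eta$ the Dedekind eta-function), so $\upsilon_k\begin{pmatrix}1&1\\0&1\end{pmatrix}=e^{2\pi i k/12}$. For $\gamma=\begin{pmatrix}a&b\\c&d\end{pmatrix}\in\Gamma$ put $(F|_k^{\upsilon}\gamma)(\tau)=\upsilon(\gamma)^{-1}(c\tau+d)^{-k}F\left(\frac{a\tau+b}{c\tau+d}\right)$. For $u$ a highest weight vector of $L_{m,n}$ (of weight $k=h_{m,n}$) the span of the linearly independent functions $S_1(u,\tau),\dots,S_d(u,\tau)$ is invariant under this action with $\upsilon=\upsilon_k$, and $\rho_{m,n}:\Gamma\to\mathrm{GL}_d(\mathbb{C})$ is the representation with $F|_k^{\upsilon}\gamma=\rho_{m,n}(\gamma)F$ for $F=(S_1(u,\tau),\dots,S_d(u,\tau))^t$. A representation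 is noncongruence if there is no $N\ge1$ such that its kernel contains the kernel $\Gamma(N)$ of $\Gamma\to\mathrm{SL}_2(\mathbb{Z}/N\mathbb{Z})$. *)

(* Defs.v *)
From HB Require Import structures.
From mathcomp Require Import all_boot all_order all_algebra.
From mathcomp Require Export complex.
From mathcomp Require Import all_classical all_reals all_analysis.

Set Implicit Arguments.
Unset Strict Implicit.
Unset Printing Implicit Defensive.

Import Order.TTheory GRing.Theory Num.Theory.
Import numFieldNormedType.Exports.

Local Open Scope classical_set_scope.
Local Open Scope complex_scope.
Local Open Scope ring_scope.

(* Vertex operator algebras, their modules and intertwining operators.  The
   vertex operator Y(v,z) = \sum_n v_n z^{-n-1} is given by its modes
   Y v n = v_n; the modes of an intertwining operator are indexed by C.       *)

Section Spaces.
Variables (C : numFieldType) (M : lmodType C).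

Definition subspace (U : set M) : Prop :=
  U 0 /\ forall (a : C) x y, U x -> U y -> U (a *: x + y).

Definition is_basis (U : set M) (n : nat) (e : 'I_n -> M) : Prop :=
  [/\ forall i, U (e i),
      forall a : 'I_n -> C, \sum_i a i *: e i = 0 -> forall i, a i = 0
    & forall x, U x -> exists a : 'I_n -> C, x = \sum_i a i *: e i].

Definition finite_dim (U : set M) : Prop :=
  exists n (e : 'I_n -> M), is_basis U e.

(* The trace on a finite dimensional subspace U stable under f. *)
Definition trace_on (U : set M) (f : M -> M) : C :=
  xget 0 [set t | exists n (e : 'I_n -> M) (A : 'M[C]_n),
    [/\ is_basis U e, forall j, f (e j) = \sum_i A i j *: e i & t = \tr A]].

Definition eigenspace_of (f : M -> M) (lambda : C) : set M :=
  [set x | f x = lambda *: x].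

End Spaces.

Section VertexOperators.
Variable C : numFieldType.

Definition binz (m : int) (i : nat) : C :=
  (\prod_(k < i) (m%:~R - k%:R)) / i`!%:R.

Definition bilinear_modes (I : Type) (W1 W2 W3 : lmodType C)
    (Y : W1 -> I -> W2 -> W3) : Prop :=
  (forall n w2, linear (fun w1 => Y w1 n w2)) /\ (forall w1 n, linear (Y w1 n)).

Definition truncated (I : pzRingType) (W1 W2 W3 : lmodType C)
    (Y : W1 -> I -> W2 -> W3) : Prop :=
  forall w1 (n : I) w2, exists N : nat, forall i : nat,
    (N <= i)%N -> Y w1 (n + i%:R) w2 = 0.

(* The Jacobi identity of a vertex operator Y of type (W3 ; W1 W2), where
   Y1, Y2, Y3 are the actions of V on W1, W2, W3, taken coefficientwise:
     \sum_i binom(m,i) (v_{l+i} w1)_{m+n-i} w2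
       = \sum_i (-1)^i binom(l,i)
           (v_{m+l-i} (w1)_{n+i} w2 - (-1)^l (w1)_{n+l-i} v_{m+i} w2).
   By truncation all but finitely many terms vanish, so that the sums over all
   i are the sums over i < K for every large enough K.                        *)
Definition jacobi_identity (I : pzRingType) (V W1 W2 W3 : lmodType C)
    (Y1 : V -> int -> W1 -> W1) (Y2 : V -> int -> W2 -> W2)
    (Y3 : V -> int -> W3 -> W3) (Y : W1 -> I -> W2 -> W3) : Prop :=
  forall v w1 w2 (l m : int) (n : I), exists K0 : nat, forall K : nat,
    (K0 <= K)%N ->
    \sum_(i < K) binz m i *: Y (Y1 v (l + i%:Z) w1) (n + (m - i%:Z)%:~R) w2 =
    \sum_(i < K) ((-1) ^+ i * binz l i) *:
      (Y3 v (m + l - i%:Z) (Y w1 (n + i%:R) w2)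
       - ((-1) ^ l : C) *: Y w1 (n + (l - i%:Z)%:~R) (Y2 v (m + i%:Z) w2)).

Record voa := VOA {
  voa_sort :> lmodType C;
  voa_op : voa_sort -> int -> voa_sort -> voa_sort;
  vacuum : voa_sort;
  conformal : voa_sort;
  central_charge : C;
  voa_bilinear : bilinear_modes voa_op;
  voa_truncated : truncated voa_op;
  voa_jacobi : jacobi_identity voa_op voa_op voa_op voa_op;
  voa_vacuum : forall n v, voa_op vacuum n v = if n == -1 then v else 0;
  voa_creation : forall v,
    voa_op v (-1) vacuum = v /\ forall n : nat, voa_op v n%:Z vacuum = 0;
  voa_virasoro : forall (m n : int) v,
    voa_op conformal (m + 1) (voa_op conformal (n + 1) v)
    - voa_op conformal (n + 1) (voa_op conformal (m + 1) v) =
    (m - n)%:~R *: voa_op conformal (m + n + 1) v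
    + (if m + n == 0 then (m ^+ 3 - m)%:~R / 12 * central_charge else 0) *: v;
  voa_derivative : forall v (n : int),
    voa_op (voa_op conformal 0 v) n =1 (fun w => (- n)%:~R *: voa_op v (n - 1) w);
  voa_graded : forall v, exists k (x : 'I_k -> voa_sort),
    v = \sum_i x i /\
    forall i, exists n : int, eigenspace_of (voa_op conformal 1) n%:~R (x i);
  voa_finite_dim : forall n : int,
    finite_dim (eigenspace_of (voa_op conformal 1) n%:~R);
  voa_bounded : exists N : int, forall n : int, n < N ->
    eigenspace_of (voa_op conformal 1) n%:~R `<=` [set 0]
}.

Record vmodule (V : voa) := VModule {
  mod_sort :> lmodType C;
  mod_op : V -> int -> mod_sort -> mod_sort;
  mod_bilinear : bilinear_modes mod_op;
  mod_truncated : truncated mod_op;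
  mod_jacobi : jacobi_identity (@voa_op V) mod_op mod_op mod_op;
  mod_vacuum : forall n w, mod_op (vacuum V) n w = if n == -1 then w else 0;
  mod_graded : forall w, exists k (x : 'I_k -> mod_sort),
    w = \sum_i x i /\
    forall i, exists lambda, eigenspace_of (mod_op (conformal V) 1) lambda (x i);
  mod_finite_dim : forall lambda,
    finite_dim (eigenspace_of (mod_op (conformal V) 1) lambda);
  mod_bounded : forall lambda, exists N : nat, forall n : nat, (N <= n)%N ->
    eigenspace_of (mod_op (conformal V) 1) (lambda - n%:R) `<=` [set 0]
}.

Definition virL (V : voa) (M : vmodule V) (n : int) : M -> M :=
  mod_op (conformal V) (n + 1).
Arguments virL {V} M n.

Definition weight_space (V : voa) (M : vmodule V) (lambda : C) : set M :=
  eigenspace_of (virL M 0) lambda.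
Arguments weight_space {V} M lambda.

Record intertwiner (V : voa) (W3 W1 W2 : vmodule V) := Intertwiner {
  int_op :> W1 -> C -> W2 -> W3;
  int_bilinear : bilinear_modes int_op;
  int_truncated : truncated int_op;
  int_jacobi : jacobi_identity (@mod_op V W1) (@mod_op V W2) (@mod_op V W3) int_op;
  int_derivative : forall w1 (n : C) w2,
    int_op (virL W1 (-1) w1) n w2 = - n *: int_op w1 (n - 1) w2
}.

Definition nonzero_intertwiner (V : voa) (W3 W1 W2 : vmodule V)
    (Y : intertwiner W3 W1 W2) : Prop :=
  exists w1 n w2, Y w1 n w2 <> 0.

(* No nonzero proper subspace is stable under all the modes. *)
Definition irreducible_action (V M : lmodType C) (act : V -> int -> M -> M) : Prop :=
  (exists x : M, x <> 0) /\
  forall U : set M, subspace U -> (forall v n x, U x -> U (act v n x)) ->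
    U `<=` [set 0] \/ U = setT.

Definition simple_voa (V : voa) : Prop := irreducible_action (@voa_op V).

Definition irreducible_module (V : voa) (M : vmodule V) : Prop :=
  irreducible_action (@mod_op V M).

(* V is spanned by the vectors L(-n_1) ... L(-n_k) vacuum. *)
Definition virasoro_generated (V : voa) : Prop :=
  forall U : set V, subspace U -> U (vacuum V) ->
    (forall n x, U x -> U (voa_op (conformal V) n x)) -> U = setT.

Definition has_conformal_weight (V : voa) (M : vmodule V) (h : C) : Prop :=
  (exists2 w, weight_space M h w & w <> 0) /\
  forall lambda w, weight_space M lambda w -> w <> 0 ->
    exists n : nat, lambda = h + n%:R.

Definition highest_weight_vector (V : voa) (M : vmodule V) (h : C) (u : M) : Prop :=
  [/\ u <> 0, weight_space M h u & forall n : int, 0 < n -> virL M n u = 0].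

(* o(u) for u of weight k *)
Definition zero_mode (V : voa) (W3 W1 W2 : vmodule V)
    (Y : intertwiner W3 W1 W2) (k : C) (u : W1) : W2 -> W3 :=
  Y u (k - 1).

End VertexOperators.

Arguments virL {C V} M n.
Arguments weight_space {C V} M lambda.

Section MinimalModels.
Variable R : realType.
Local Notation C := R[i].

Definition minimal_charge (p q : nat) : R :=
  1 - 6 * (p%:R - q%:R) ^+ 2 / (p%:R * q%:R).

Definition minimal_weight (p q m n : nat) : R :=
  ((n%:R * p%:R - m%:R * q%:R) ^+ 2 - (p%:R - q%:R) ^+ 2) / (4 * p%:R * q%:R).

(* V is (a copy of) the Virasoro minimal model V(p,q) = L(c,0). *)
Definition minimal_model (p q : nat) (V : voa C) : Prop :=
  [/\ central_charge V = (minimal_charge p q)%:C,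
      virasoro_generated V & simple_voa V].

(* For coprime p and q the conformal weight h_{m,n} determines the irreducible
   V(p,q)-module L_{m,n} = L_{p-m,q-n} up to isomorphism. *)
Definition is_Lmn (p q m n : nat) (V : voa C) (M : vmodule V) : Prop :=
  irreducible_module M /\ has_conformal_weight M (minimal_weight p q m n)%:C.

Definition admissible (p q m n : nat) (x : nat * nat) : Prop :=
  [/\ (0 < m < p)%N /\ (0 < x.1 < p)%N, (0 < n < q)%N /\ (0 < x.2 < q)%N,
      (m < 2 * x.1)%N /\ (n < 2 * x.2)%N,
      (m + 2 * x.1 < 2 * p)%N /\ (n + 2 * x.2 < 2 * q)%N
    & odd (m + 2 * x.1) /\ odd (n + 2 * x.2)].

Definition equivalent_triples (p q : nat) (x y : nat * nat) : Prop :=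
  y = x \/ y = ((p - x.1)%N, (q - x.2)%N).

Definition complete_list (p q m n d : nat) (t : 'I_d -> nat * nat) : Prop :=
  [/\ forall j, admissible p q m n (t j),
      forall i j, equivalent_triples p q (t i) (t j) -> i = j
    & forall x, admissible p q m n x -> exists j, equivalent_triples p q (t j) x].

Definition cexp (z : C) : C :=
  (expR (complex.Re z))%:C * (cos (complex.Im z) +i* sin (complex.Im z)).

(* principal argument, in ]-pi, pi] *)
Definition carg (z : C) : R :=
  let t := acos (complex.Re z / complex.Re `|z|) in
  if 0 <= complex.Im z then t else - t.

Definition clog (z : C) : C := ln (complex.Re `|z|) +i* carg z.

Definition cpow (z : C) (k : R) : C := cexp (k%:C * clog z).

Definition upper_half : set C := [set tau | 0 < complex.Im tau].

(* q^x, where q = e^{2 pi i tau} *)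
Definition qpow (tau : C) (x : R) : C := cexp ((2 * pi * x)%:C * 'i%C * tau).

(* The value at tau of S(u,tau) = tr_M o(u) q^{L(0)-c/24} is F, for M of
   conformal weight h, so that the L(0)-weights of M are the h + n. *)
Definition one_point_value (V : voa C) (L M : vmodule V) (Y : intertwiner M L M)
    (c h k : R) (u : L) (tau F : C) : Prop :=
  (fun N : nat => \sum_(n < N)
     trace_on (weight_space M (h + n%:R)%:C) (zero_mode Y k%:C u)
     * qpow tau (h + n%:R - c / 24) : C^o) @ \oo --> (F : C^o).

Definition SL2Z : {pred 'M[int]_2} := [pred g | \det g == 1].

Definition automorphy (g : 'M[int]_2) (tau : C) : C :=
  (g 1 0)%:~R * tau + (g 1 1)%:~R.

Definition moebius (g : 'M[int]_2) (tau : C) : C :=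
  ((g 0 0)%:~R * tau + (g 0 1)%:~R) / automorphy g tau.

(* The branch  pi i tau / 12 + \sum_(n >= 1) log (1 - q^n)  of the logarithm of
   the Dedekind eta function q^{1/24} \prod_(n >= 1) (1 - q^n) on the upper
   half-plane. *)
Definition log_eta (tau : C) : C :=
  (pi / 12)%:C * 'i%C * tau
  + limn (fun N : nat => \sum_(1 <= n < N) clog (1 - qpow tau n%:R) : C^o).

Definition eta_pow (x : R) (tau : C) : C := cexp (x%:C * log_eta tau).

(* upsilon is the multiplier system of weight k of eta^{2k}; changing the branch
   of log eta multiplies eta^{2k} by a constant and does not affect upsilon. *)
Definition eta_multiplier (k : R) (upsilon : 'M[int]_2 -> C) : Prop :=
  forall g tau, g \in SL2Z -> upper_half tau ->
    eta_pow (2 * k) (moebius g tau) =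
    upsilon g * cpow (automorphy g tau) k * eta_pow (2 * k) tau.

Definition slash (k : R) (upsilon : 'M[int]_2 -> C) (F : C -> C)
    (g : 'M[int]_2) (tau : C) : C :=
  (upsilon g)^-1 * cpow (automorphy g tau) (- k) * F (moebius g tau).

(* Only the restriction of rho to SL_2(Z) matters. *)
Definition is_representation (d : nat) (rho : 'M[int]_2 -> 'M[C]_d) : Prop :=
  rho 1%:M = 1%:M /\
  forall g g', g \in SL2Z -> g' \in SL2Z -> rho (g *m g') = rho g *m rho g'.

Definition in_principal_congruence (N : nat) (g : 'M[int]_2) : Prop :=
  g \in SL2Z /\ forall i j, (g i j = (1%:M : 'M[int]_2) i j %[mod N%:Z])%Z.

Definition noncongruence (d : nat) (rho : 'M[int]_2 -> 'M[C]_d) : Prop :=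
  ~ exists2 N : nat, (1 <= N)%N &
      forall g, in_principal_congruence N g -> rho g = 1%:M.

(* rho is the representation rho_{m,n} attached to L = L_{m,n}. *)
Definition associated_representation (p q m n : nat) (V : voa C) (L : vmodule V)
    (d : nat) (rho : 'M[int]_2 -> 'M[C]_d) : Prop :=
  let k := minimal_weight p q m n in
  exists (t : 'I_d -> nat * nat) (M : 'I_d -> vmodule V)
         (Y : forall j, intertwiner (M j) L (M j)) (u : L)
         (F : 'I_d -> C -> C) (upsilon : 'M[int]_2 -> C),
    [/\ complete_list p q m n t,
        forall j, is_Lmn p q (t j).1 (t j).2 (M j),
        forall j, nonzero_intertwiner (Y j),
        highest_weight_vector k%:C u
      & [/\ forall j tau, upper_half tau ->
              one_point_value (Y j) (minimal_charge p q)
                (minimal_weight p q (t j).1 (t j).2) k u tau (F j tau),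
            eta_multiplier k upsilon,
            is_representation rho
          & forall g tau j, g \in SL2Z -> upper_half tau ->
              slash k upsilon (F j) g tau = \sum_i rho g j i * F i tau]].

End MinimalModels.

(* Main.v *)
Require Import Defs.
From mathcomp Require Import all_boot all_order all_algebra.
From mathcomp Require Import all_classical all_reals all_analysis.
From mathcomp Require Import zify ring lra.

Set Implicit Arguments.
Unset Strict Implicit.
Unset Printing Implicit Defensive.

Import Order.TTheory GRing.Theory Num.Theory.
Import numFieldNormedType.Exports.
Local Open Scope ring_scope.

Local Notation subspace := Defs.subspace.

(** The obstruction is the spectrum of rho(T), T being the matrix of the
    translation tau |-> tau + 1.  Suppose that Gamma(N) lies in the kernel of rho
    and let u be prime to N.  Some g in SL_2(Z) is congruent to diag(u, u^-1)
    modulo N, and then g T = T^(u^2) g modulo Gamma(N).  Hence the u^2-th power of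
    every eigenvalue of rho(T) is again an eigenvalue ([congruence_spectrum]).

    The spectrum is known explicitly.  The function S_j(u, tau) is
    q^{h_j - c/24} (a_0 + a_1 q + ...), where a_0 is the trace of o(u) on the
    lowest weight space of L_{m_j,n_j}.  This space is a line, and a_0 is not 0:
    otherwise all the modes of u would map L_{m_j,n_j} into the span of the higher
    weight spaces, and since their images span a submodule, u would act as 0, and
    with u the whole of L_{m,n} ([top_trace_neq0]).  Inequivalent triples have
    distinct h_j, so the S_j are linearly independent, and S_j(u, tau + 1) is a
    multiple of S_j(u, tau).  Therefore rho(T) is diagonal with the entries
    e^{2 pi i (h_j - c/24 - k/12)}, where k/12 is the contribution of eta^{2k}
    ([associated_translation]).

    The exponents are X_j / (48 p q) for integers X_j that are congruent to
    q^2 (12 m_j^2 - m^2 + 1) modulo p.  The roles of (p, m) and (q, n) are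
    symmetric, so let alpha < m; then m >= 3.  The stability of the spectrum says
    that the set of the residues 12 j^2 - m^2 + 1 modulo p = r^a, for
    m < 2 j < 2 p - m, is stable under multiplication by the squares of the
    residues prime to r.  This is
    impossible when 3 <= m <= p - 4 ([no_square_closed_range]).  If a = 1 the set
    has (r - m)/2 elements and one of them is not 0, but the orbit of that one has
    (r - 1)/2 elements.  If a > 1, the squares of the units congruent to 1 modulo
    P = r^(a-1) move y to y + c y P for all c, which amounts to translating j by
    all multiples of P as soon as j and 12 j^2 - m^2 + 1 are prime to r.  But there
    is such a j in the interval ]m/2, p - m/2[ with a translate in ]-m/2, m/2[,
    outside the range. *)

(** * Quadratic residues modulo a prime power *)

Lemma prime_dvdzM (r : nat) (x y : int) : prime r ->
  (r%:Z %| x * y)%Z = (r%:Z %| x)%Z || (r%:Z %| y)%Z.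
Proof. by move=> pr; rewrite !dvdzE abszM Euclid_dvdM. Qed.

Lemma ndvdz_small (r x : nat) : (0 < x < r)%N -> ~~ (r%:Z %| x%:Z)%Z.
Proof.
move=> /andP[x0 xr]; rewrite dvdzE /=; apply/negP => /(dvdn_leq x0).
by rewrite leqNgt xr.
Qed.

Lemma dvdz_linear_solve (r : nat) (y z : int) : prime r -> ~~ (r%:Z %| y)%Z ->
  exists c : nat, (r%:Z %| c%:Z * y - z)%Z.
Proof.
move=> pr ry.
have cop : coprimez r%:Z y.
  by rewrite coprimezE prime_coprime //; move: ry; rewrite dvdzE.
have [[v w] /= vw] := coprimezP _ _ cop.
have rn0 : r%:Z != 0 by have := prime_gt0 pr; lia.
exists `|((w * z) %% r%:Z)%Z|%N.
rewrite gez0_abs ?modz_ge0 //.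
rewrite -eqz_mod_dvd modzMml; apply/eqP.
have wy : w * y = 1 - v * r%:Z by rewrite -vw; ring.
have -> : w * z * y = z + (- v * z) * r%:Z by rewrite mulrAC wy; ring.
by rewrite addrC modzMDl.
Qed.

Lemma ndvdz_between (p : nat) (x : int) : 0 < x < p%:Z -> ~~ (p%:Z %| x)%Z.
Proof.
case: x => // x; rewrite !ltz_nat => /andP[x0 xp].
by rewrite dvdzE /= gtnNdvd.
Qed.

(** The part modulo p of 48 p q times the exponent of an eigenvalue of rho(T),
    up to the unit q^2; see [exponent_numerator_dvd]. *)
Definition qform (m : nat) (j : int) : int := 12 * j ^+ 2 - m%:Z ^+ 2 + 1.

Definition in_range (p m j : nat) : Prop := (m < 2 * j)%N /\ (m + 2 * j < 2 * p)%N.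

Section SquareClosed.
Variables (r a m p : nat).
Hypotheses (r_prime : prime r) (r_gt3 : (3 < r)%N) (m_odd : odd m).
Hypotheses (def_p : p = (r ^ a)%N) (m_ge3 : (3 <= m)%N) (m_le : (m + 4 <= p)%N).

Local Notation phi := (qform m).
Local Notation inJ := (in_range p m).

Hypothesis closed : forall u j : nat, coprime r u -> inJ j ->
  exists2 j' : nat, inJ j' & (p%:Z %| u%:Z ^+ 2 * phi j%:Z - phi j'%:Z)%Z.

Lemma r_ndvd12 : ~~ (r%:Z %| 12%:Z)%Z.
Proof.
have h2 : ~~ (r%:Z %| 2%:Z)%Z by apply: ndvdz_small; lia.
have h3 : ~~ (r%:Z %| 3%:Z)%Z by apply: ndvdz_small; lia.
by rewrite (_ : 12%:Z = 2%:Z * (2%:Z * 3%:Z)) // !prime_dvdzM // !negb_or h2 h3.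
Qed.

(** As r does not divide 2 x, it cannot divide both x - y and x + y; so x is
    determined up to sign by its value, even though p is not prime. *)
Lemma phi_cancel (x y : int) : ~~ (r%:Z %| x)%Z -> (p%:Z %| phi x - phi y)%Z ->
  (p%:Z %| x - y)%Z || (p%:Z %| x + y)%Z.
Proof.
move=> rx.
have -> : phi x - phi y = 12%:Z * ((x - y) * (x + y)) by rewrite /qform; ring.
have cop z : ~~ (r%:Z %| z)%Z -> coprimez p%:Z z.
  by move=> rz; rewrite coprimezE def_p /= coprimeXl // prime_coprime //; move: rz; rewrite dvdzE.
rewrite Gauss_dvdzr ?cop ?r_ndvd12 //.
have [rxy|rxy] := boolP (r%:Z %| x - y)%Z.
  have rxy' : ~~ (r%:Z %| x + y)%Z.
    apply/negP => h.
    have : (r%:Z %| 2%:Z * x)%Z.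
      by rewrite (_ : 2%:Z * x = (x - y) + (x + y)); [exact: rpredD | ring].
    rewrite prime_dvdzM // (negbTE rx) orbF; apply/negP.
    by apply: ndvdz_small; lia.
  by rewrite mulrC Gauss_dvdzr ?cop // => ->.
by rewrite Gauss_dvdzr ?cop // => ->; rewrite orbT.
Qed.

(** The case a > 1 rests on the units u = 1 + c P: modulo p the square of u adds
    2 c P phi(j) to phi(j), while replacing j by j - e P adds - 24 e j P.  As
    phi(j) is prime to r, some c equates the two, so that the value at j0 must be
    a value on the range.  By [phi_cancel] it is not, for |2 j0| < m. *)
Lemma no_translate_out (P : nat) (j : nat) (j0 e : int) :
  p = (P * r)%N -> (r %| P)%N -> inJ j -> - m%:Z < 2 * j0 -> 2 * j0 < m%:Z ->
  j%:Z = j0 + e * P%:Z -> ~~ (r%:Z %| j0)%Z -> ~~ (r%:Z %| phi j0)%Z -> False.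
Proof.
move=> pP /dvdnP[Q PQ] Jj j0l j0u jE rj0 rphi.
have rP : (r%:Z %| P%:Z)%Z by rewrite PQ PoszM dvdz_mull.
have rphij : ~~ (r%:Z %| 2 * phi j%:Z)%Z.
  rewrite prime_dvdzM // negb_or; apply/andP; split.
    by apply: ndvdz_small; lia.
  apply: contra rphi => h.
  rewrite (_ : phi j0 = phi j%:Z + (- 24 * j0 * e - 12 * e ^+ 2 * P%:Z) * P%:Z).
    by rewrite rpredD // dvdz_mull.
  by rewrite jE /qform; ring.
have [c hc] := dvdz_linear_solve (- 24 * e * j%:Z) r_prime rphij.
have cop : coprime r (1 + c * P).
  by rewrite PQ mulnA /coprime addnC gcdnMDl gcdn1.
have [j' [Jj'1 Jj'2] hj'] := closed cop Jj.
have : (p%:Z %| phi j0 - phi j'%:Z)%Z.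
  have -> : phi j0 - phi j'%:Z = ((1 + c * P)%:Z ^+ 2 * phi j%:Z - phi j'%:Z) -
    P%:Z * (c%:Z * (2 * phi j%:Z) - (- 24 * e * j%:Z) +
      P%:Z * (c%:Z ^+ 2 * phi j%:Z - 12 * e ^+ 2)).
    by rewrite PoszD PoszM jE /qform; ring.
  rewrite rpredB // pP PoszM dvdz_mul // rpredD //.
  by rewrite dvdz_mulr.
move=> /(phi_cancel rj0); clear -j0l j0u Jj'1 Jj'2.
rewrite -opprB rpredN => /orP[]; apply/negP/ndvdz_between; lia.
Qed.

Lemma r_odd : odd r.
Proof. by case: (even_prime r_prime) => // r2; move: r_gt3; rewrite r2. Qed.

Lemma ndvd2 : ~~ (r%:Z %| 2%:Z)%Z.
Proof. by apply: ndvdz_small; lia. Qed.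

Lemma dvd_p : (0 < a)%N -> (r%:Z %| p%:Z)%Z.
Proof. by move=> a0; rewrite dvdzE /= def_p dvdn_exp. Qed.

(** The points (p - 1)/2 and (p - 3)/2 are in the range because m <= p - 4.  They
    are congruent to -1/2 and -3/2 modulo r, and their values differ by -24, so r
    cannot divide both. *)
Lemma unit_value_in_range : (0 < a)%N ->
  exists j : nat, [/\ inJ j, ~~ (r%:Z %| j%:Z)%Z & ~~ (r%:Z %| phi j%:Z)%Z].
Proof.
move=> a0; have rp := dvd_p a0.
have p_odd : odd p by rewrite def_p oddX r_odd orbT.
have nr x : ~~ (r%:Z %| x)%Z -> forall z, z = p%:Z - x -> ~~ (r%:Z %| z)%Z.
  by move=> rx z zE; apply: contra rx => rz; rewrite (_ : x = p%:Z - z) ?rpredB // zE; ring.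
have nr2 (x : int) : ~~ (r%:Z %| 2 * x)%Z -> ~~ (r%:Z %| x)%Z.
  by apply: contra => h; rewrite dvdz_mull.
pose j1 := p.-1./2; pose j2 := (j1 - 1)%N.
have e1 : (2 * j1 + 1 = p)%N by rewrite /j1; lia.
have e2 : (2 * j2 + 3 = p)%N by rewrite /j2; lia.
have [h|h] := boolP (r%:Z %| phi j1%:Z)%Z; last first.
  exists j1; split=> //; first by split; lia.
  by apply/nr2/(nr 1%:Z); [apply: ndvdz_small | ]; lia.
exists j2; split; first by split; lia.
  by apply/nr2/(nr 3%:Z); [apply: ndvdz_small | ]; lia.
apply/negP => h2.
have : (r%:Z %| phi j1%:Z - phi j2%:Z)%Z by rewrite rpredB.
have -> : phi j1%:Z - phi j2%:Z = 12%:Z * (p%:Z - 2%:Z).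
  rewrite /qform (_ : j2%:Z = j1%:Z - 1); last lia.
  rewrite (_ : p%:Z = 2 * j1%:Z + 1); [ring | lia].
rewrite prime_dvdzM // (negbTE r_ndvd12) /=; apply/negP.
by apply: (nr 2%:Z) => //; exact: ndvd2.
Qed.

Lemma no_square_closed_prime_power : (1 < a)%N -> False.
Proof.
move=> a1; pose P := (r ^ a.-1)%N.
have pP : p = (P * r)%N by rewrite def_p /P -expnSr prednK //; lia.
have rP : (r %| P)%N by rewrite dvdn_exp //; lia.
have P_odd : odd P by rewrite /P oddX r_odd orbT.
have [mP|Pm] := ltnP m P.
  (* The gap ]-m/2, m/2[ is shorter than P: its points 1 and 2 are translated by
     P into the range.  For m = 3 only 1 is in the gap, but its value is 4. *)
  have good j : (0 < j)%N -> (2 * j < m)%N -> (j < 3)%N ->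
      ~~ (r%:Z %| phi j%:Z)%Z -> False.
    move=> j0 jm j3 gj.
    apply: (@no_translate_out P (j + P) j%:Z 1) => //; try lia.
      by split; [lia | nia].
    by apply: ndvdz_small; lia.
  have [m5|m3] := ltnP 4 m; last first.
    apply: (good 1%N) => //; have -> : m = 3%N by move: m_odd; lia.
    by rewrite (_ : qform 3 1%:Z = 2%:Z * 2%:Z) // prime_dvdzM // negb_or ndvd2.
  have [h1|] := boolP (r%:Z %| phi 1%:Z)%Z; last by apply: good; lia.
  have [h2|] := boolP (r%:Z %| phi 2%:Z)%Z; last by apply: good; lia.
  have : (r%:Z %| phi 2%:Z - phi 1%:Z)%Z by rewrite rpredB.
  rewrite (_ : phi 2%:Z - phi 1%:Z = 12%:Z * 3%:Z); last by rewrite /qform; ring.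
  rewrite prime_dvdzM // (negbTE r_ndvd12) /=; apply/negP.
  by apply: ndvdz_small; lia.
(* The gap has at least P points, so it meets every class modulo P; x - P/2 is
   the representative of j of least absolute value. *)
have [j [Jj rj rphi]] := unit_value_in_range (ltnW a1).
pose e := ((j + P./2) %/ P)%N; pose x := ((j + P./2) %% P)%N.
have P0 : (0 < P)%N by rewrite expn_gt0 prime_gt0.
have xP : (x < P)%N by rewrite ltn_mod.
have jE : (j + P./2 = e * P + x)%N := divn_eq _ _.
have rPz : (r%:Z %| P%:Z)%Z by rewrite dvdzE.
apply: (@no_translate_out P j (x%:Z - P./2%:Z) e%:Z) => //.
- lia.
- lia.
- by rewrite -PoszM; lia.
- apply: contra rj => h; rewrite (_ : j%:Z = (x%:Z - P./2%:Z) + e%:Z * P%:Z); last by lia.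
  by rewrite rpredD // dvdz_mull.
- apply: contra rphi => h; rewrite (_ : j%:Z = (x%:Z - P./2%:Z) + e%:Z * P%:Z); last by lia.
  set y := _ - _; rewrite (_ : phi _ = phi y + (24 * y * e%:Z + 12 * e%:Z ^+ 2 * P%:Z) * P%:Z).
    by rewrite rpredD // dvdz_mull.
  by rewrite /qform; ring.
Qed.

Lemma no_square_closed_prime : a = 1%N -> False.
Proof.
move=> a1; have pr : p = r by rewrite def_p a1 expn1.
have [j [Jj rj rphi]] := unit_value_in_range (eq_leq (esym a1)).
have odd_r := r_odd.
(* Up to sign the range has (r - m)/2 points, numbered from (m + 1)/2. *)
have orbit (i : 'I_r./2) : exists k : 'I_((r - m)./2),
    (r%:Z %| i.+1%:Z ^+ 2 * phi j%:Z - phi (k + m./2 + 1)%:Z)%Z.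
  have cop : coprime r i.+1.
    rewrite prime_coprime //; apply/negP => /(dvdn_leq (ltn0Sn _)).
    by have := ltn_ord i; lia.
  have [j' [Jj1 Jj2] hj'] := closed cop Jj; rewrite pr in Jj2 hj'.
  have [jr|jr] := leqP j' r./2.
    have lk : (j' - m./2 - 1 < (r - m)./2)%N by lia.
    exists (Ordinal lk); have -> : (Ordinal lk + m./2 + 1)%N = j' by rewrite /=; lia.
    by [].
  have lk : (r - j' - m./2 - 1 < (r - m)./2)%N by lia.
  exists (Ordinal lk); have -> : (Ordinal lk + m./2 + 1)%:Z = r%:Z - j'%:Z by rewrite /=; lia.
  rewrite (_ : _ - _ = (i.+1%:Z ^+ 2 * phi j%:Z - phi j'%:Z) + r%:Z * (24 * j'%:Z - 12 * r%:Z)).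
    by rewrite rpredD // dvdz_mulr.
  by rewrite /qform; ring.
have [f hf] := choice orbit.
have f_inj : injective f.
  move=> i i' ff; have := rpredB (hf i) (hf i'); rewrite ff.
  rewrite (_ : _ - _ = (i%:Z - i'%:Z) * (i%:Z + i'%:Z + 2) * phi j%:Z); last first.
    by rewrite !intS; ring.
  have li := ltn_ord i; have li' := ltn_ord i'.
  rewrite !prime_dvdzM // (negbTE rphi) orbF => /orP[]; last first.
    rewrite -!PoszD => h; exfalso; move: h; apply/negP.
    by apply: ndvdz_small; lia.
  have [ii|ii|ii _] := ltngtP i i'; last exact: val_inj.
    rewrite (_ : _ - _ = - (i' - i)%:Z); last lia.
    rewrite rpredN => h; exfalso; move: h; apply/negP.
    by apply: ndvdz_small; lia.
  rewrite (_ : _ - _ = (i - i')%:Z); last lia.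
  move=> h; exfalso; move: h; apply/negP.
  by apply: ndvdz_small; lia.
have := leq_card f f_inj; rewrite !card_ord; lia.
Qed.

End SquareClosed.

(** The Chinese remainder theorem trades the units prime to N for all the units
    modulo r^a, whether r divides N or not. *)
Lemma coprime_lift (N u : nat) (r a : nat) : prime r -> (0 < a)%N -> (0 < N)%N ->
  coprime r u -> exists2 v : nat, coprime v N & ((r ^ a)%N%:Z %| v%:Z - u%:Z)%Z.
Proof.
move=> pr a0 N0 ru; pose N' := (N`_r^')%N.
have copN' : coprime (r ^ a) N'.
  by apply: coprimeXl; rewrite prime_coprime // -p'natE // part_pnat.
have vu := chinese_modl copN' u 1; have v1 := chinese_modr copN' u 1.
exists (chinese (r ^ a) N' u 1); last first.
  by rewrite -eqz_mod_dvd !modz_nat eqz_nat; apply/eqP.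
rewrite -(partnC r N0) coprimeMr; apply/andP; split.
  rewrite p_part; apply: coprimeXr; rewrite coprime_sym -(coprime_pexpl _ _ a0).
  by rewrite -coprime_modr vu coprime_modr coprimeXl.
by rewrite -coprime_modl v1 coprime_modl coprime1n.
Qed.

Lemma no_square_closed_range (r a m p N : nat) :
  prime r -> (3 < r)%N -> odd m -> p = (r ^ a)%N -> (3 <= m)%N -> (m + 4 <= p)%N ->
  (0 < a)%N -> (0 < N)%N ->
  ~ (forall u j : nat, coprime u N -> in_range p m j ->
      exists2 j' : nat, in_range p m j' & (p%:Z %| u%:Z ^+ 2 * qform m j%:Z - qform m j'%:Z)%Z).
Proof.
move=> pr r3 om pE m3 mp a0 N0 H.
have closed u j : coprime r u -> in_range p m j -> exists2 j' : nat,
    in_range p m j' & (p%:Z %| u%:Z ^+ 2 * qform m j%:Z - qform m j'%:Z)%Z.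
  move=> ru Jj; have [v vN vu] := coprime_lift pr a0 N0 ru.
  have [j' Jj' h] := H v j vN Jj; exists j' => //.
  have -> : u%:Z ^+ 2 * qform m j%:Z - qform m j'%:Z =
     (v%:Z ^+ 2 * qform m j%:Z - qform m j'%:Z)
     - (v%:Z + u%:Z) * qform m j%:Z * (v%:Z - u%:Z) by ring.
  by rewrite rpredB // pE dvdz_mull.
have [a1|a1|a1] := ltngtP a 1.
- by move: a1; rewrite ltnS leqNgt a0.
- exact: (no_square_closed_prime_power pr r3 om pE m3 mp closed a1).
- exact: (no_square_closed_prime pr r3 om pE m3 mp closed a1).
Qed.

(** * Linear maps, subspaces and the trace on a line *)

Section Linear.
Variable C : numFieldType.
Implicit Types M N : lmodType C.

Lemma linear_zero M N (f : M -> N) : linear f -> f 0 = 0.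
Proof. by move=> lf; have := lf (-1) 0 0; rewrite scaler0 scaleN1r addNr addr0. Qed.

Lemma linear_scale M N (f : M -> N) : linear f -> forall a x, f (a *: x) = a *: f x.
Proof. by move=> lf a x; have := lf a x 0; rewrite (linear_zero lf) !addr0. Qed.

Lemma linear_add M N (f : M -> N) : linear f -> forall x y, f (x + y) = f x + f y.
Proof. by move=> lf x y; have := lf 1 x y; rewrite !scale1r. Qed.

Lemma linear_sum M N (f : M -> N) : linear f ->
  forall (I : Type) (r : seq I) (P : pred I) (F : I -> M),
  f (\sum_(i <- r | P i) F i) = \sum_(i <- r | P i) f (F i).
Proof.
move=> lf I r P F; apply: big_morph; last exact: linear_zero.
exact: linear_add.
Qed.

Lemma linear_sub M N (f : M -> N) : linear f -> forall x y, f (x - y) = f x - f y.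
Proof.
move=> lf x y; rewrite linear_add //; congr (_ + _).
by rewrite -scaleN1r linear_scale // scaleN1r.
Qed.

Lemma subspace_scale M (U : set M) a x : subspace U -> U x -> U (a *: x).
Proof. by case=> U0 UD Ux; rewrite -[_ *: _]addr0; exact: UD. Qed.

Lemma subspace_add M (U : set M) x y : subspace U -> U x -> U y -> U (x + y).
Proof. by case=> U0 UD Ux Uy; rewrite -[x]scale1r; exact: UD. Qed.

Lemma subspace_sub M (U : set M) x y : subspace U -> U x -> U y -> U (x - y).
Proof.
move=> sU Ux Uy; rewrite -[- y]scaleN1r.
by apply: subspace_add => //; exact: subspace_scale.
Qed.

Lemma subspace_sum M (U : set M) (I : Type) (r : seq I) (F : I -> M) :
  subspace U -> (forall i, U (F i)) -> U (\sum_(i <- r) F i).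
Proof.
move=> sU UF; elim/big_ind: _ => //; first by case: sU.
by move=> x y; exact: subspace_add.
Qed.

(** The trace is chosen among the traces of all the matrices of f on U, so the
    point is that every basis of a line has exactly one element. *)
Lemma trace_on_line M (w : M) (U : set M) (f : M -> M) (c : C) :
  w <> 0 -> U w -> (forall x, U x -> exists a, x = a *: w) ->
  linear f -> f w = c *: w -> trace_on U f = c.
Proof.
move=> w0 Uw Uline lf fw.
have fU x : U x -> f x = c *: x.
  by move=> /Uline[a ->]; rewrite linear_scale // fw !scalerA mulrC.
have wit : [set t | exists n (e : 'I_n -> M) (A : 'M[C]_n),
    [/\ is_basis U e, forall j, f (e j) = \sum_i A i j *: e i & t = \tr A]]%classic c.
  exists 1%N, (fun=> w), c%:M; split.
  - split=> // [a|x /Uline[a ->]].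
      rewrite big_ord1 => /eqP; rewrite scaler_eq0 => /orP[/eqP a0 i|/eqP//].
      by rewrite ord1.
    by exists (fun=> a); rewrite big_ord1.
  - by move=> j; rewrite big_ord1 (ord1 j) mxE eqxx.
  - by rewrite mxtrace_scalar.
rewrite /trace_on; case: xgetP => [t _|/(_ c)//].
case=> -[|[|n]] [e [A [[Ue free gen] fe ->]]].
- by have [a] := gen _ Uw; rewrite big_ord0.
- have := fe ord0; rewrite big_ord1 fU // /mxtrace big_ord1 => /eqP.
  rewrite -subr_eq0 -scalerBl scaler_eq0 subr_eq0 => /orP[/eqP//|/eqP e0].
  have := free (fun=> 1); rewrite big_ord1 scale1r => /(_ e0 ord0)/eqP.
  by rewrite oner_eq0.
- have [b0 e0] := Uline _ (Ue ord0); have [b1 e1] := Uline _ (Ue ord_max).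
  have dep (x y : C) : x *: e ord0 + y *: e ord_max = 0 -> x = 0 /\ y = 0.
    move=> xy.
    pose a (i : 'I_n.+2) := if i == ord0 then x else if i == ord_max then y else 0.
    have : \sum_i a i *: e i = 0.
      rewrite (bigD1 ord0) //= (bigD1 ord_max) //= big1 ?addr0.
        by rewrite /a /= eqxx.
      by move=> i /andP[i0 i1]; rewrite /a (negbTE i0) (negbTE i1) scale0r.
    by move=> /free h; have := h ord_max; have := h ord0; rewrite /a /= eqxx.
  have [b10 _] : b1 = 0 /\ - b0 = 0.
    by apply: dep; rewrite e0 e1 !scalerA mulNr mulrC scaleNr subrr.
  have [_ /eqP] : 0 = 0 :> C /\ 1 = 0 :> C.
    by apply: dep; rewrite e1 b10 !scale0r scaler0 addr0.
  by rewrite oner_eq0.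
Qed.

End Linear.

(** * Consequences of the Jacobi identity *)

Section Modes.
Variable C : numFieldType.

Lemma binz_0 (m : int) : binz C m 0 = 1.
Proof. by rewrite /binz big_ord0 fact0 divr1. Qed.

Lemma binz_1 (m : int) : binz C m 1 = m%:~R.
Proof. by rewrite /binz big_ord1 subr0 divr1. Qed.

Lemma binz_0S (i : nat) : binz C 0 i.+1 = 0.
Proof. by rewrite /binz big_ord_recl subrr !mul0r. Qed.

Lemma sum_binz0 (M : lmodType C) (F : nat -> M) (K : nat) : (0 < K)%N ->
  \sum_(i < K) binz C 0 i *: F i = F 0%N.
Proof.
case: K => // K _; rewrite big_ord_recl binz_0 scale1r big1 ?addr0 //.
by move=> i _; rewrite binz_0S scale0r.
Qed.

Lemma sum_truncate (M : lmodType C) (F : nat -> M) (k K : nat) : (k <= K)%N ->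
  (forall i, (k <= i)%N -> F i = 0) -> \sum_(i < K) F i = \sum_(i < k) F i.
Proof.
move=> kK F0; rewrite -!(big_mkord xpredT) (big_cat_nat _ kK) //=.
rewrite [X in _ + X]big_nat_cond [X in _ + X]big1 ?addr0 // => i.
by rewrite andbT => /andP[/F0].
Qed.

Variables (I : pzRingType) (V W1 W2 W3 : lmodType C).
Variables (Y1 : V -> int -> W1 -> W1) (Y2 : V -> int -> W2 -> W2).
Variables (Y3 : V -> int -> W3 -> W3) (Y : W1 -> I -> W2 -> W3).
Hypothesis jac : jacobi_identity Y1 Y2 Y3 Y.
Hypothesis bilY : bilinear_modes Y.

(** The case l = 0 of the Jacobi identity: only the term i = 0 is left on the
    right. *)
Lemma commutator_formula v w1 w2 (m : int) (n : I) (k : nat) :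
  (forall i : nat, (k <= i)%N -> Y1 v i w1 = 0) ->
  Y3 v m (Y w1 n w2) - Y w1 n (Y2 v m w2) =
  \sum_(i < k) binz C m i *: Y (Y1 v i w1) (n + (m - i%:Z)%:~R) w2.
Proof.
move=> trunc; have lY := bilY.1 _ w2.
have [K0 jK] := jac v w1 w2 0 m n.
have := jK (K0 + k).+1 (leqW (leq_addr _ _)).
under [X in _ = X -> _]eq_bigr do rewrite mulrC -scalerA.
rewrite (sum_binz0 (fun i : nat => (-1) ^+ i *: (Y3 v (m + 0 - i%:Z) (Y w1 (n + i%:R) w2)
  - ((-1) ^ 0 : C) *: Y w1 (n + (0 - i%:Z)%:~R) (Y2 v (m + i%:Z) w2)))) //.
rewrite expr0 scale1r !addr0 expr0z scale1r => <-.
rewrite -(sum_truncate (F := fun i => binz C m i *: Y (Y1 v i w1) (n + (m - i%:Z)%:~R) w2)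
  (leqW (leq_addl K0 k))).
  by apply: eq_bigr => i _; rewrite add0r.
by move=> i ki; rewrite trunc // (linear_zero (lY _)) scaler0.
Qed.

(** The case m = 0 of the Jacobi identity: only the term i = 0 is left on the
    left. *)
Lemma iterate_formula v w1 w2 (l : int) (n : I) : exists K : nat,
  Y (Y1 v l w1) n w2 = \sum_(i < K) ((-1) ^+ i * binz C l i) *:
      (Y3 v (l - i%:Z) (Y w1 (n + i%:R) w2)
       - ((-1) ^ l : C) *: Y w1 (n + (l - i%:Z)%:~R) (Y2 v i w2)).
Proof.
have [K0 /(_ K0.+1 (leqnSn _))] := jac v w1 w2 l 0 n.
rewrite (sum_binz0 (fun i => Y (Y1 v (l + i%:Z) w1) (n + (0 - i%:Z)%:~R) w2)) //.
rewrite subr0 !addr0 => ->; exists K0.+1.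
by apply: eq_bigr => i _; rewrite !add0r.
Qed.

End Modes.

(** * The Virasoro algebra acting on a module *)

Section VirasoroAction.
Variables (C : numFieldType) (V : voa C).
Local Notation omega := (conformal V).

(** Read off from the bracket of L(i-1) with L(-2), applied to the vacuum: this
    vector is killed by L(n) for n >= -1, and L(-2) maps it to omega. *)
Lemma conformal_modes_conformal (i : nat) : (2 <= i)%N ->
  voa_op omega i omega = (if i == 3%N then central_charge V / 2 else 0) *: vacuum V.
Proof.
move=> i2; have [cr _] := @voa_creation _ V omega.
have vac n := (@voa_creation _ V omega).2 n.
have := @voa_virasoro _ V (i%:Z - 1) (- 2) (vacuum V).
rewrite !subrK (_ : -2 + 1 = -1 :> int) // cr vac.
rewrite (linear_zero ((@voa_bilinear _ V).2 omega (-1))) subr0 => ->.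
rewrite (_ : i%:Z - 1 - 2 + 1 = (i - 2)%N%:Z); last by lia.
rewrite vac scaler0 add0r; have [->|i3] := eqVneq i 3%N.
  congr (_ *: _).
  rewrite (_ : ((3%:Z - 1) ^+ 3 - (3%:Z - 1))%:~R = 6 :> C) //.
  by field.
by rewrite (_ : (i%:Z - 1 - 2 == 0) = false) //; apply/eqP; lia.
Qed.

Lemma conformal_mode1_conformal : voa_op omega 1 omega = 2 *: omega.
Proof.
have [cr _] := @voa_creation _ V omega.
have vac n := (@voa_creation _ V omega).2 n.
have := @voa_virasoro _ V 0 (- 2) (vacuum V).
rewrite !add0r (_ : -2 + 1 = -1 :> int) // cr vac.
rewrite (linear_zero ((@voa_bilinear _ V).2 omega (-1))) subr0 => ->.
by rewrite /= scale0r addr0 opprK.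
Qed.

Variable M : vmodule V.
Local Notation opv := (@mod_op _ _ M).

Lemma mod_op_linear v n : linear (opv v n).
Proof. exact: (@mod_bilinear _ _ M).2. Qed.

Lemma mod_op_linearl n w : linear (fun v => opv v n w).
Proof. exact: (@mod_bilinear _ _ M).1. Qed.

Lemma conformal_commutator (a b : int) (x : M) :
  opv omega a (opv omega b x) - opv omega b (opv omega a x) =
  opv (voa_op omega 0 omega) (a + b) x + (2 * a)%:~R *: opv omega (a + b - 1) x
  + (if a + b == 2 then binz C a 3 * central_charge V / 2 else 0) *: x.
Proof.
rewrite (commutator_formula (@mod_jacobi _ _ M) (@mod_bilinear _ _ M) _ _ _ (k := 4)); last first.
  move=> i i4; rewrite conformal_modes_conformal ?(leq_trans _ i4) //.
  by case: eqP i4 => [->//|_ _]; rewrite scale0r.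
rewrite !big_ord_recr big_ord0 /= add0r.
have z n := linear_zero (mod_op_linearl n x).
rewrite (conformal_modes_conformal (i := 2)) // (conformal_modes_conformal (i := 3)) //.
rewrite conformal_mode1_conformal /= scale0r z scaler0 addr0.
rewrite !(linear_scale (mod_op_linearl _ x)) binz_0 binz_1 scale1r !intz.
congr (_ + _ + _).
- by congr (mod_op _ _ _); ring.
- rewrite scalerA; congr (_ *: mod_op _ _ _); last by ring.
  by rewrite rmorphM /= mulrC.
- rewrite mod_vacuum (_ : (b + (a - 3%:Z) == -1) = (a + b == 2)); last by lia.
  by case: ifP; rewrite ?scaler0 ?scale0r // scalerA mulrA.
Qed.

(** The bracket of omega_k and omega_0 is computed twice by
    [conformal_commutator]; its antisymmetry leaves no choice for the modes of
    L(-1) omega, because the central terms binom(k,3) and binom(0,3) vanish where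
    k = 2. *)
Lemma conformal_derivative (k : int) (x : M) :
  opv (voa_op omega 0 omega) k x = (- k)%:~R *: opv omega (k - 1) x.
Proof.
have e1 := conformal_commutator k 0 x; have e2 := conformal_commutator 0 k x.
have b0 : binz C 0 3 = 0 by exact: binz_0S.
have b2 : binz C 2 3 = 0 by rewrite /binz !big_ord_recr big_ord0 /= subrr mulr0 mul0r.
have c1 : (if k + 0 == 2 then binz C k 3 * central_charge V / 2 else 0) = 0.
  by rewrite addr0; case: eqP => // ->; rewrite b2 !mul0r.
rewrite c1 scale0r addr0 addr0 in e1.
rewrite b0 !mul0r if_same scale0r addr0 mulr0 scale0r addr0 add0r in e2.
have := congr2 +%R e1 e2; rewrite addrA subrK subrr => /esym /eqP.
set y := opv _ k x; set z := opv _ _ x.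
rewrite addrAC -mulr2n addr_eq0 -scaler_nat => /eqP e.
apply: (scalerI (a := 2%:R : C)); first by rewrite pnatr_eq0.
by rewrite e scalerA -scaleNr rmorphN rmorphM /= mulrN.
Qed.

Lemma mod_virasoro (m n : int) (x : M) :
  virL M m (virL M n x) - virL M n (virL M m x) =
  (m - n)%:~R *: virL M (m + n) x
  + (if m + n == 0 then (m ^+ 3 - m)%:~R / 12 * central_charge V else 0) *: x.
Proof.
rewrite /virL conformal_commutator conformal_derivative -scalerDl -rmorphD /=.
congr (_ *: mod_op _ _ _ + _ *: _); try by (congr (_%:~R) || idtac); ring.
rewrite (_ : (m + 1 + (n + 1) == 2) = (m + n == 0)); last by lia.
case: ifP => // _; rewrite /binz !big_ord_recr big_ord0 /=.
rewrite (_ : 3`!%:R = 6 :> C) // !rmorphB !rmorphD rmorphXn /=.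
by field.
Qed.

End VirasoroAction.

(** * The lowest weight space of an irreducible module *)

Section IrreducibleModules.
Variables (C : numFieldType) (V : voa C).
Hypothesis V_gen : virasoro_generated V.

Lemma virL_linear (M : vmodule V) n : linear (virL M n).
Proof. exact: mod_op_linear. Qed.

(** A subspace stable under the modes of omega is stable under all modes: by the
    iterate formula the v that stabilize it form a subspace of V that contains the
    vacuum and is stable under the modes of omega. *)
Lemma virasoro_irreducible (M : vmodule V) (U : set M) : irreducible_module M ->
  subspace U -> (forall n x, U x -> U (virL M n x)) ->
  forall y, U y -> y <> 0 -> forall x, U x.
Proof.
move=> [_ irr] sU Uvir y Uy y0.
have [U0|->//] : (U `<=` [set 0])%classic \/ U = setT; last by case: y0; exact: U0.
apply: (irr U sU) => v n x Ux; move: n x Ux.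
pose A := [set v : V | forall n x, U x -> U (mod_op v n x)]%classic.
suff AT : A = setT by have : A v by rewrite AT.
apply: V_gen.
- split=> [n x Ux|c v1 v2 Av1 Av2 n x Ux].
    by rewrite (linear_zero (mod_op_linearl n x)); case: sU.
  by rewrite (mod_op_linearl n x); apply: (proj2 sU); [exact: Av1 | exact: Av2].
- by move=> n x Ux; rewrite mod_vacuum; case: ifP => // _; case: sU.
- move=> k v1 Av1 n x Ux.
  have Uom j z : U z -> U (mod_op (conformal V) j z).
    by move=> Uz; have := Uvir (j - 1) z Uz; rewrite /virL subrK.
  have [K ->] := iterate_formula (@mod_jacobi _ _ M) (conformal V) v1 x k n.
  apply: subspace_sum => // i; apply: subspace_scale => //.
  apply: subspace_sub => //; first by apply: Uom; exact: Av1.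
  by apply: subspace_scale => //; apply: Av1; exact: Uom.
Qed.

Section OffWeight.
Variables (M : vmodule V) (h : C).

Let shift (lambda : C) (x : M) : M := virL M 0 x - lambda *: x.
Let shifts (s : seq C) (x : M) : M := foldr shift x s.

(** The span of the weight spaces for weights other than h, described by
    annihilating polynomials: x is killed by a product of factors L(0) - lambda
    with lambda <> h.  Disjointness from the weight space of h is then immediate,
    since such a product acts there by a nonzero scalar. *)
Definition off_weight : set M :=
  [set x | exists2 s : seq C, h \notin s & shifts s x = 0]%classic.

Let shift_linear lambda : linear (shift lambda).
Proof.
move=> a x y; rewrite /shift virL_linear scalerBr scalerDr opprD addrACA.
by rewrite !scalerA [lambda * a]mulrC.
Qed.

Let shifts_cons l s x : shifts (l :: s) x = shift l (shifts s x).
Proof. by []. Qed.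

Let shifts_cat s t x : shifts (s ++ t) x = shifts s (shifts t x).
Proof. exact: foldr_cat. Qed.

Let shifts_linear s : linear (shifts s).
Proof.
by elim: s => [//|l s IHs] a x y; rewrite !shifts_cons IHs shift_linear.
Qed.

Let shifts_shift l s x : shifts s (shift l x) = shift l (shifts s x).
Proof.
elim: s => // l' s IHs; rewrite !shifts_cons IHs; set y := shifts s x.
rewrite /shift !(linear_sub (virL_linear _)) !(linear_scale (virL_linear _)).
rewrite !scalerBr !scalerA [l * l']mulrC !opprB -!addrA.
by congr (_ + _); rewrite addrC -addrA [RHS]addrCA.
Qed.

Let shifts_comm s t x : shifts s (shifts t x) = shifts t (shifts s x).
Proof. by elim: s => // l s IHs; rewrite !shifts_cons IHs shifts_shift. Qed.

Lemma off_weight_subspace : subspace off_weight.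
Proof.
have z s : shifts s 0 = 0 := linear_zero (shifts_linear s).
split=> [|a x y [s hs sx] [t ht ty]]; first by exists [::].
exists (s ++ t); first by rewrite mem_cat negb_or hs ht.
by rewrite shifts_linear !shifts_cat ty shifts_comm sx !z scaler0 addr0.
Qed.

Lemma weight_off_weight lambda x :
  weight_space M lambda x -> lambda != h -> off_weight x.
Proof.
move=> wx lh; exists [:: lambda]; first by rewrite inE eq_sym.
by rewrite /= /shift wx subrr.
Qed.

Lemma weight_off_weight_eq0 x : weight_space M h x -> off_weight x -> x = 0.
Proof.
move=> wx [s hs sx].
have sE (t : seq C) : h \notin t -> exists2 a : C, a != 0 & shifts t x = a *: x.
  elim: t => [_|l t IHt]; first by exists 1; rewrite ?oner_eq0 ?scale1r.
  rewrite inE negb_or => /andP[hl /IHt[a a0 ta]]; exists (a * (h - l)).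
    by rewrite mulf_neq0 // subr_eq0.
  rewrite shifts_cons ta (linear_scale (shift_linear l)) /shift wx.
  by rewrite -scalerBl scalerA.
have [a a0] := sE s hs; rewrite sx => /esym/eqP.
by rewrite scaler_eq0 (negbTE a0) => /eqP.
Qed.

Lemma virL_weight n lambda x : weight_space M lambda x ->
  weight_space M (lambda - n%:~R) (virL M n x).
Proof.
move=> wx; have := mod_virasoro 0 n x.
rewrite wx (linear_scale (virL_linear n)) !add0r => /eqP.
rewrite subr_eq => /eqP; rewrite /weight_space /eigenspace_of /= => ->.
rewrite rmorphN /= oppr0 !mul0r.
by rewrite if_same scale0r addr0 -scalerDl addrC.
Qed.

Hypothesis M_weight : has_conformal_weight M h.

Lemma virL_raising_off_weight n x : n < 0 -> off_weight (virL M n x).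
Proof.
move=> n0; have [k [y [-> hy]]] := mod_graded x.
rewrite (linear_sum (virL_linear n)); apply: subspace_sum => [|i].
  exact: off_weight_subspace.
have [lambda wy] := hy i.
have [->|y0] := eqVneq (y i) 0.
  by rewrite (linear_zero (virL_linear n)); case: off_weight_subspace.
have wy' : weight_space M lambda (y i) by rewrite /weight_space /virL add0r.
have [j lE] := M_weight.2 _ _ wy' (elimN eqP y0).
apply: (weight_off_weight (virL_weight n wy')); rewrite lE.
rewrite -addrA -[X in _ != X]addr0 (inj_eq (addrI h)).
have -> : j%:R - n%:~R = (j%:Z - n)%:~R :> C by rewrite rmorphB.
by rewrite intr_eq0; lia.
Qed.

Lemma virL_lowering_top n w : weight_space M h w -> 0 < n -> virL M n w = 0.
Proof.
move=> ww n0; apply: contrapT => nz.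
have [j /eqP] := M_weight.2 _ _ (virL_weight n ww) nz.
rewrite (inj_eq (addrI h)) -subr_eq0.
have -> : - n%:~R - j%:R = (- n - j%:Z)%:~R :> C by rewrite rmorphB rmorphN.
by rewrite intr_eq0; lia.
Qed.

Hypothesis M_irr : irreducible_module M.
Variable w : M.
Hypotheses (w_top : weight_space M h w) (w_neq0 : w <> 0).

(** M is spanned by the L(-n_1) ... L(-n_k) w with all n_i > 0: moving L(n), n >= 0,
    to the right through such a product shows that their span is stable under the
    Virasoro algebra. *)
Lemma raising_ind (P : set M) : subspace P -> P w ->
  (forall n x, n < 0 -> P x -> P (virL M n x)) -> forall x, P x.
Proof.
move=> sP Pw Pvir.
pose W := [set x : M | forall U : set M, subspace U -> U w ->
  (forall n y, n < 0 -> U y -> U (virL M n y)) -> U x]%classic.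
suff WT x : W x by move=> x; exact: WT x P sP Pw Pvir.
have sW : subspace W.
  split=> [U []//|a y z Wy Wz U sU Uw Uv].
  by apply: (proj2 sU); [exact: Wy | exact: Wz].
have Ww : W w by [].
have Wneg n y : n < 0 -> W y -> W (virL M n y).
  by move=> n0 Wy U sU Uw Uv; exact: Uv n y n0 (Wy U sU Uw Uv).
apply: (virasoro_irreducible M_irr sW _ Ww w_neq0) => n y Wy.
have [n0|n0] := ltP n 0; first exact: Wneg.
suff : W y /\ forall m, 0 <= m -> W (virL M m y) by case=> _; apply.
apply: (Wy [set y | W y /\ forall m, 0 <= m -> W (virL M m y)]%classic).
- split=> [|a y1 y2 [Wy1 Wy1'] [Wy2 Wy2']].
    by split=> [|m m0]; rewrite ?(linear_zero (virL_linear m)); case: sW.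
  split=> [|m m0]; first exact: (sW.2 a y1 y2 Wy1 Wy2).
  rewrite virL_linear; exact: (sW.2 _ _ _ (Wy1' m m0) (Wy2' m m0)).
- split=> // m; rewrite le_eqVlt => /orP[/eqP<-|m0].
    by rewrite w_top; exact: (subspace_scale _ sW Ww).
  by rewrite virL_lowering_top //; case: sW.
- move=> k z k0 [Wz Wz']; split=> [|m m0]; first exact: Wneg.
  have /eqP := mod_virasoro m k z; rewrite subr_eq => /eqP ->.
  apply: (subspace_add sW); last exact: Wneg k0 (Wz' m m0).
  apply: (subspace_add sW); apply: (subspace_scale _ sW) => //.
  by have [?|?] := ltP (m + k) 0; [exact: Wneg | exact: Wz'].
Qed.

(** In the spanning family of [raising_ind] only w itself has weight h. *)
Lemma top_weight_line x : weight_space M h x -> exists a, x = a *: w.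
Proof.
move=> wx.
have [a ax] : exists a, off_weight (x - a *: w).
  apply: (raising_ind (P := [set x | exists a, off_weight (x - a *: w)]%classic)).
  - have [z0 zD] := off_weight_subspace.
    split=> [|b y z [a1 o1] [a2 o2]]; first by exists 0; rewrite scale0r subrr.
    exists (b * a1 + a2).
    have -> : b *: y + z - (b * a1 + a2) *: w = b *: (y - a1 *: w) + (z - a2 *: w).
      by rewrite scalerDl scalerBr scalerA opprD addrACA.
    exact: zD.
  - by exists 1; rewrite scale1r subrr; case: off_weight_subspace.
  - move=> n y n0 _; exists 0; rewrite scale0r subr0.
    exact: virL_raising_off_weight.
exists a; apply/eqP; rewrite -subr_eq0; apply/eqP; apply: weight_off_weight_eq0 ax.
rewrite /weight_space /eigenspace_of /= (linear_sub (virL_linear 0)).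
by rewrite (linear_scale (virL_linear 0)) wx w_top scalerBr !scalerA mulrC.
Qed.

End OffWeight.

(** * The leading coefficient of a 1-point function *)

Section Intertwiners.
Variables (L M : vmodule V) (Y : intertwiner M L M) (k h : C) (u : L).
Hypotheses (L_irr : irreducible_module L) (M_irr : irreducible_module M).
Hypotheses (M_weight : has_conformal_weight M h).
Hypotheses (u_hwv : highest_weight_vector k u) (Y_neq0 : nonzero_intertwiner Y).

(** For a highest weight vector only the terms in L(-1) u and L(0) u of the
    commutator formula are left. *)
Lemma primary_commutator (n : int) (r : C) (x : M) :
  virL M n (Y u r x) - Y u r (virL M n x) =
  ((n + 1)%:~R * (k - 1) - r) *: Y u (r + n%:~R) x.
Proof.
have [_ u1 u2] := u_hwv.
rewrite (commutator_formula (@int_jacobi _ _ _ _ _ Y) (@int_bilinear _ _ _ _ _ Y)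
  _ _ _ (k := 2)); last first.
  by move=> [|[|i]] // _; have := u2 i.+1%:Z; rewrite /virL -PoszD addn1; apply.
have l0 : mod_op (conformal V) 0 u = virL L (-1) u by [].
have l1 : mod_op (conformal V) 1 u = k *: u by rewrite -u1.
rewrite !big_ord_recr big_ord0 /= add0r l0 l1 int_derivative binz_0 binz_1 scale1r.
rewrite (linear_scale ((@int_bilinear _ _ _ _ _ Y).1 _ _)) scalerA.
rewrite subr0 (_ : r + (n + 1 - 1)%:~R = r + n%:~R); last by rewrite addrK.
rewrite (_ : r + (n + 1)%:~R - 1 = r + n%:~R); last by rewrite rmorphD /=; ring.
by rewrite -scalerDl; congr (_ *: _); ring.
Qed.

(** If o(u) kills the lowest weight line, then so does the projection to this line
    of every Y(u) x, by induction on x along [raising_ind].  The span of all the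
    Y(u) x is then a submodule that misses the line, hence 0; and the vectors v
    with Y(v) = 0 form a submodule, so that Y = 0. *)
Lemma top_trace_neq0 :
  trace_on (weight_space M h) (zero_mode Y k u) != 0.
Proof.
have linY r : linear (Y u r) := (@int_bilinear _ _ _ _ _ Y).2 u r.
have [w ww w0] := M_weight.1.
have Yw r : weight_space M (h + (k - 1) - r) (Y u r w).
  have := primary_commutator 0 r w.
  rewrite ww (linear_scale (linY r)) addr0 mul1r => /eqP.
  rewrite subr_eq => /eqP; rewrite /weight_space /eigenspace_of /= => ->.
  by rewrite -scalerDl; congr (_ *: _); ring.
(* o(u) preserves the weight, hence acts on the line of w by a scalar c. *)
have [c cE] : exists c, Y u (k - 1) w = c *: w.
  apply: (top_weight_line M_weight M_irr ww w0).
  by have := Yw (k - 1); rewrite addrK.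
rewrite (trace_on_line w0 ww _ (linY _) cE); last first.
  by move=> x; exact: (top_weight_line M_weight M_irr ww w0).
apply/eqP => c0; rewrite {}c0 scale0r in cE.
have sN := off_weight_subspace M h.
have offY r x : off_weight h (Y u r x).
  move: x r; apply: (raising_ind M_weight M_irr ww w0
    (P := [set x | forall r, off_weight h (Y u r x)]%classic)).
  - split=> [r|a x y ox oy r]; first by rewrite (linear_zero (linY r)); case: sN.
    by rewrite linY; apply: (proj2 sN).
  - move=> r; have [->|rk] := eqVneq r (k - 1); first by rewrite cE; case: sN.
    by apply: (weight_off_weight (Yw r)); rewrite -addrA -[X in _ != X]addr0
      (inj_eq (addrI h)) subr_eq0 eq_sym.
  - move=> n x n0 ox r.
    have := primary_commutator n r x => /eqP; rewrite subr_eq addrC -subr_eq => /eqP <-.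
    apply: subspace_sub => //; first exact: virL_raising_off_weight.
    exact: subspace_scale.
have Yu0 r x : Y u r x = 0.
  apply: contrapT => nz.
  pose K := [set z : M | forall U : set M, subspace U ->
    (forall r x, U (Y u r x)) -> U z]%classic.
  have sK : subspace K.
    split=> [U []//|a y z Ky Kz U sU Uy].
    by apply: (proj2 sU); [exact: Ky | exact: Kz].
  have KY r' x' : K (Y u r' x') by move=> U sU; exact.
  have Kw : K w.
    apply: (virasoro_irreducible M_irr sK _ (KY r x) nz) => n z Kz.
    apply: (Kz [set z | K (virL M n z)]%classic).
      split=> [|a y1 y2 K1 K2]; first by rewrite /= (linear_zero (virL_linear n)); case: sK.
      by rewrite /= virL_linear; exact: (sK.2 _ _ _ K1 K2).
    move=> r' x' /=.
    have := primary_commutator n r' x' => /eqP; rewrite subr_eq => /eqP ->.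
    exact: (subspace_add sK (subspace_scale _ sK (KY _ _)) (KY _ _)).
  by apply: w0; apply: weight_off_weight_eq0 ww (Kw _ sN _) => r' x'; exact: offY.
have [w1 [r [x []]]] := Y_neq0.
apply: (virasoro_irreducible L_irr
  (U := [set v | forall r x, Y v r x = 0]%classic) _ _ (y := u)) => //=.
- split=> [r' x'|a v1 v2 Y1 Y2 r' x'].
    exact: linear_zero ((@int_bilinear _ _ _ _ _ Y).1 r' x').
  by rewrite ((@int_bilinear _ _ _ _ _ Y).1 r' x') Y1 Y2 scaler0 addr0.
- move=> n v Yv r' x'.
  have [K ->] := iterate_formula (@int_jacobi _ _ _ _ _ Y) (conformal V) v x' (n + 1) r'.
  rewrite big1 // => i _; rewrite !Yv (linear_zero (mod_op_linear _ _)).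
  by rewrite scaler0 subr0 scaler0.
- by case: u_hwv.
Qed.

End Intertwiners.
End IrreducibleModules.

(** * The complex exponential *)

Section ComplexExponential.
Variable R : realType.
Local Notation C := R[i].
Local Open Scope complex_scope.

Lemma cexpD (z w : C) : cexp (z + w) = cexp z * cexp w.
Proof.
case: z w => [a b] [c d]; rewrite /cexp /= expRD cosD sinD.
apply/eqP; rewrite eq_complex /=; apply/andP; split; apply/eqP; ring.
Qed.

Lemma cexp_real (x : R) : cexp x%:C = (expR x)%:C.
Proof.
rewrite /cexp /= cos0 sin0; apply/eqP; rewrite eq_complex /=.
by apply/andP; split; apply/eqP; ring.
Qed.

Lemma cexp0 : cexp 0 = 1 :> C.
Proof. by rewrite (_ : 0 = 0%:C) // cexp_real expR0. Qed.

Lemma cexp_neq0 (z : C) : cexp z != 0.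
Proof.
apply/eqP => z0; have /eqP := cexpD z (- z).
by rewrite subrr cexp0 z0 mul0r oner_eq0.
Qed.

Lemma cexpN (z : C) : cexp (- z) = (cexp z)^-1.
Proof.
apply: (mulfI (cexp_neq0 z)); rewrite -cexpD subrr cexp0 mulfV //.
exact: cexp_neq0.
Qed.

(** e^{2 pi i x} for real x *)
Definition unit_exp (x : R) : C := cexp ((2 * pi * x)%:C * 'i).

Lemma unit_expD (x y : R) : unit_exp (x + y) = unit_exp x * unit_exp y.
Proof. by rewrite /unit_exp -cexpD -mulrDl -rmorphD /= mulrDr. Qed.

Lemma unit_expN (x : R) : unit_exp (- x) = (unit_exp x)^-1.
Proof. by rewrite /unit_exp -cexpN mulrN rmorphN /= mulNr. Qed.

Lemma unit_expX (x : R) n : unit_exp x ^+ n = unit_exp (n%:R * x).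
Proof.
elim: n => [|n IHn]; first by rewrite mul0r /unit_exp mulr0 mul0r cexp0.
by rewrite exprS IHn -unit_expD -[in RHS]natr1 mulrDl mul1r addrC.
Qed.

Lemma unit_expE (x : R) : unit_exp x = cos (2 * pi * x) +i* sin (2 * pi * x).
Proof.
rewrite /unit_exp (_ : _ * _ = 0 +i* (2 * pi * x)).
  by rewrite /cexp /= expR0 rmorph1 mul1r.
by apply/eqP; rewrite eq_complex /=; apply/andP; split; apply/eqP; ring.
Qed.

Lemma unit_exp_int (z : int) : unit_exp z%:~R = 1.
Proof.
have e1 : unit_exp 1 = 1.
  rewrite unit_expE mulr1 mulr_natl cos2pi.
  by rewrite (_ : pi *+ 2 = 0 + pi *+ 2) ?add0r // -[pi *+ 2]add0r sinD2pi sin0.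
have en (n : nat) : unit_exp n%:R = 1 by rewrite -[n%:R]mulr1 -unit_expX e1 expr1n.
case: z => n; first exact: en.
by rewrite NegzE rmorphN /= unit_expN en invr1.
Qed.

(** Modulo the integer part x is in [0, 1[, and after x |-> 1 - x in [0, 1/2],
    where the cosine of 2 pi x is injective. *)
Lemma unit_exp_eq1 (x : R) : unit_exp x = 1 -> exists z : int, x = z%:~R.
Proof.
move=> x1; exists (Num.floor x); apply/eqP; rewrite -subr_eq0; apply/eqP.
set f := x - _.
have f1 : unit_exp f = 1.
  by rewrite /f unit_expD x1 mul1r unit_expN unit_exp_int invr1.
have [f0 fl1] : 0 <= f /\ f < 1.
  rewrite /f subr_ge0 ltrBlDl Num.Theory.floor_le; split=> //.
  by rewrite -intrD1; exact: Num.Theory.floorD1_gt.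
have pi0 := @pi_gt0 R.
have zero (y : R) : 0 <= y -> 2 * y <= 1 -> unit_exp y = 1 -> y = 0.
  move=> y0 y1; rewrite unit_expE => /eqP; rewrite eq_complex /= => /andP[/eqP c1 _].
  have : 2 * pi * y = 0.
    apply: cos_inj; rewrite ?cos0 // in_itv /=; last by rewrite lexx ltW.
    by apply/andP; split; nra.
  by move=> /eqP; rewrite !mulf_eq0 pnatr_eq0 (gt_eqF pi0) /= => /eqP.
have [h|h] := lerP (2 * f) 1; first exact: zero.
have : 1 - f = 0.
  apply: zero; [lra | lra |].
  by rewrite unit_expD unit_expN f1 (unit_exp_int 1) invr1 mulr1.
lra.
Qed.

End ComplexExponential.

(** * Leading terms of q-series on the imaginary axis *)

Section QSeries.
Variable R : realType.
Local Notation C := R[i].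
Local Open Scope complex_scope.
Local Open Scope classical_set_scope.

Lemma qpow_translate (tau : C) (x : R) :
  qpow (tau + 1) x = unit_exp x * qpow tau x.
Proof. by rewrite /qpow /unit_exp -cexpD mulrDr mulr1 addrC. Qed.

Lemma qpow_imaginary (y x : R) : qpow (0 +i* y) x = (expR (- (2 * pi * x * y)))%:C.
Proof.
rewrite /qpow -cexp_real; congr cexp; apply/eqP; rewrite eq_complex /=.
by apply/andP; split; apply/eqP; ring.
Qed.

Lemma eq_cvgn (u v : nat -> C^o) (l : C^o) : u =1 v ->
  v @ \oo --> l -> u @ \oo --> l.
Proof. by move=> uv; rewrite (eq_cvg _ _ uv). Qed.

Lemma cvgn_mulr (u : nat -> C) (l b : C) :
  (u n : C^o) @[n --> \oo] --> (l : C^o) ->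
  (u n * b : C^o) @[n --> \oo] --> (l * b : C^o).
Proof. by move=> ul; exact: cvgMr_tmp. Qed.

Lemma cvgn_mull (u : nat -> C) (l b : C) :
  (u n : C^o) @[n --> \oo] --> (l : C^o) ->
  (b * u n : C^o) @[n --> \oo] --> (b * l : C^o).
Proof. by move=> ul; exact: cvgMl_tmp. Qed.

Lemma cvg_exp_complex (x : R) : 0 <= x < 1 ->
  (fun n : nat => (x ^+ n)%:C : C^o) @ \oo --> (0 : C^o).
Proof.
move=> /andP[x0 x1]; apply/cvgr0Pnorm_lt => e e0.
have [er ei] : 0 < complex.Re e /\ complex.Im e = 0.
  by move: e0; rewrite ltcE /= => /andP[/eqP<-].
have xe : \forall n \near \oo, `|x ^+ n| < complex.Re e.
  by apply: (cvgr0_norm_lt _ (cvg_expr _)) => //; rewrite ger0_norm.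
near=> n; have : `|x ^+ n| < complex.Re e by near: n.
rewrite ger0_norm ?exprn_ge0 // normc_def /= expr0n addr0 sqrtr_sqr ger0_norm ?exprn_ge0 //.
by rewrite ltcE /= ei eqxx.
Unshelve. all: by end_near.
Qed.

Lemma cvg_dominated (u : nat -> C) (v : nat -> C) (l : C) :
  (forall n, `|u n - l| <= `|v n|) -> (v n : C^o) @[n --> \oo] --> (0 : C^o) ->
  (u n : C^o) @[n --> \oo] --> (l : C^o).
Proof.
move=> uv v0; apply/cvgrPdistC_lt => e e0.
have ve : \forall n \near \oo, `|v n| < e by exact: (cvgr0_norm_lt _ v0).
near=> n; apply: (le_lt_trans (uv n)); near: n.
exact: ve.
Unshelve. all: by end_near.
Qed.

Lemma geometric_sum_le (z : C) K : 0 < z < 1 -> \sum_(i < K) z ^+ i <= (1 - z)^-1.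
Proof.
move=> /andP[z0 z1]; have z1' : 0 < 1 - z by rewrite subr_gt0.
rewrite -(ler_pM2l z1') mulfV ?gt_eqF // -opprB mulNr -subrX1 opprB.
by rewrite gerBl exprn_ge0 // ltW.
Qed.

Lemma bounded_terms (b : nat -> C) (l : C) :
  (fun K : nat => \sum_(n < K) b n : C^o) @ \oo --> (l : C^o) ->
  exists M : C, forall n, `|b n| <= M.
Proof.
move=> bl; have bnd := cvg_seq_bounded (cvgP _ bl).
have [M hM] := @filter_ex _ _ (@proper_pinfty_nbhs C) _ bnd; exists (M + M) => n.
have -> : b n = \sum_(i < n.+1) b i - \sum_(i < n) b i by rewrite big_ord_recr /= addrAC subrr add0r.
by apply: (le_trans (ler_normB _ _)); apply: lerD; exact: hM.
Qed.

(** Convergence at s bounds the a_n s^n, so that the series at s^(N+2) differs from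
    a_0 by at most a multiple of s^(N+1). *)
Lemma power_series_leading (a : nat -> C) (s : R) (G : nat -> C) : 0 < s < 1 ->
  (forall N : nat, (fun K : nat =>
     \sum_(n < K) a n * ((s ^+ (n * N.+1))%:C) : C^o) @ \oo --> (G N : C^o)) ->
  (G N : C^o) @[N --> \oo] --> (a 0%N : C^o).
Proof.
move=> /andP[s0 s1] hG; pose z : C := s%:C.
have z0 : 0 < z by rewrite /z ltcR.
have z1 : z < 1 by rewrite -(rmorph1 (real_complex R)) ltcR.
have zE n : (s ^+ n)%:C = z ^+ n by rewrite rmorphXn.
have [M hM] := @bounded_terms (fun n => a n * (s ^+ (n * 1))%:C) _ (hG 0%N).
have M0 : 0 <= M := le_trans (normr_ge0 _) (hM 0%N).
pose B := M / (1 - z) + 1.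
have B0 : 0 <= B by rewrite addr_ge0 // divr_ge0 // subr_ge0 ltW.
have tail N K : `|\sum_(n < K.+1) a n * ((s ^+ (n * N.+2))%:C) - a 0%N| <= M / (1 - z) * z ^+ N.+1.
  rewrite big_ord_recl mul0n expr0 mulr1 addrAC subrr add0r.
  apply: (le_trans (ler_norm_sum _ _ _)).
  apply: (@le_trans _ _ (\sum_(i < K) M * z ^+ N.+1 * z ^+ i)); last first.
    rewrite -mulr_sumr mulrAC; apply: ler_wpM2r; first by rewrite exprn_ge0 // ltW.
    by apply: ler_wpM2l => //; apply: geometric_sum_le; rewrite z0.
  apply: ler_sum => i _; rewrite lift0 zE.
  rewrite (_ : (i.+1 * N.+2 = i.+1 * 1 + i.+1 * N.+1)%N); last by rewrite -mulnDr.
  rewrite exprD mulrA normrM -zE -[X in _ <= X]mulrA -exprD.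
  apply: ler_pM => //.
  rewrite normrX gtr0_norm //; apply: ler_wiXn2l; rewrite ?(ltW z0) ?(ltW z1) //.
  by nia.
rewrite -(cvg_shiftS (G : nat -> C^o)); apply: (@cvg_dominated _ (fun N => B * z ^+ N.+1)).
  move=> N; have zN : 0 < z ^+ N.+1 by rewrite exprn_gt0.
  (* The summand 1 of B absorbs the error of a partial sum within s^(N+1) of G. *)
  have /cvgrPdist_lt /(_ _ zN) near1 := hG N.+1.
  have near2 : \forall K \near \oo, (0 < K)%N by exists 1%N.
  have [K [K1 K2]] := filter_ex (filterI near1 near2).
  case: K K1 K2 => // K K1 _.
  rewrite [X in _ <= X]ger0_norm ?mulr_ge0 ?(ltW zN) // /B mulrDl mul1r [X in _ <= X]addrC.
  apply: (le_trans (ler_distD (\sum_(n < K.+1) a n * ((s ^+ (n * N.+2))%:C)) _ _)).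
  by apply: lerD; [exact: ltW | exact: tail].
rewrite -(mulr0 B); apply: cvgMl_tmp.
rewrite (cvg_shiftS (fun n => z ^+ n : C^o)).
under eq_cvg do rewrite -zE.
by apply: cvg_exp_complex; rewrite ltW.
Qed.

Lemma qseries_leading (a : nat -> C) (e : R) (F : C -> C) :
  (forall tau, upper_half tau ->
     (fun K : nat => \sum_(n < K) a n * qpow tau (e + n%:R) : C^o) @ \oo --> (F tau : C^o)) ->
  (F (0 +i* N.+1%:R) * (expR (2 * pi * e * N.+1%:R))%:C : C^o) @[N --> \oo] --> (a 0%N : C^o).
Proof.
move=> hF; apply: (@power_series_leading a (expR (- (2 * pi)))).
  by rewrite expR_gt0 expR_lt1 oppr_lt0 mulr_gt0 ?pi_gt0.
move=> N; have up : upper_half (0 +i* N.+1%:R : C) by rewrite /upper_half /= ltr0n.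
have h := cvgn_mulr (b := (expR (2 * pi * e * N.+1%:R))%:C) (hF _ up).
apply: (eq_cvgn _ h) => K /=.
rewrite mulr_suml; apply: eq_bigr => n _.
rewrite -mulrA qpow_imaginary; congr (_ * _); rewrite -[RHS]rmorphM /= -expRD -expRM_natl.
by congr ((expR _)%:C); rewrite natrM; ring.
Qed.

(** Among the j with c_j <> 0 take the one with the least exponent; dividing the
    relation by its leading power of q and letting tau tend to i oo isolates its
    leading term, since the exponents are distinct. *)
Lemma leading_exponents_independent (d : nat) (e : 'I_d -> R) (a : 'I_d -> C)
    (F : 'I_d -> C -> C) (c : 'I_d -> C) :
  injective e -> (forall j, a j != 0) ->
  (forall j, (F j (0 +i* N.+1%:R) * (expR (2 * pi * e j * N.+1%:R))%:C : C^o)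
     @[N --> \oo] --> (a j : C^o)) ->
  (forall N : nat, \sum_j c j * F j (0 +i* N.+1%:R) = 0) -> forall j, c j = 0.
Proof.
move=> e_inj a0 Fa cF j0; apply/eqP; apply: contraT => cj0.
have [i ci imin] := Order.TotalTheory.arg_minP (P := fun j => c j != 0) e cj0.
pose term j (N : nat) : C := c j * (F j (0 +i* N.+1%:R) *
  (expR (2 * pi * e j * N.+1%:R))%:C) * (expR (- (2 * pi * (e j - e i))) ^+ N.+1)%:C.
pose limit j : C := if j == i then c i * a i else 0.
have lim_term j : (term j N : C^o) @[N --> \oo] --> (limit j : C^o).
  rewrite /limit; have [->|ji] := eqVneq j i.
    rewrite /term subrr mulr0 oppr0 expR0.
    have h := cvgn_mull (b := c i) (Fa i); apply: (eq_cvgn _ h) => N.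
    by rewrite expr1n rmorph1 mulr1.
  have [cj|cj] := eqVneq (c j) 0.
    apply: (eq_cvgn _ (cvg_cst (0 : C^o))) => N.
    by rewrite /term cj !mul0r.
  have eij : e i < e j by rewrite lt_neqAle imin // andbT; apply: contra ji => /eqP/e_inj->.
  rewrite -(mulr0 (c j * a j)); apply: cvgM.
    exact: cvgn_mull (Fa j).
  rewrite (cvg_shiftS (fun N => (expR (- (2 * pi * (e j - e i))) ^+ N)%:C : C^o)).
  apply: cvg_exp_complex; rewrite expR_ge0 expR_lt1 oppr_lt0.
  by rewrite !mulr_gt0 ?pi_gt0 // subr_gt0.
have lim_sum : (\sum_j term j N : C^o) @[N --> \oo] --> (\sum_j limit j : C^o).
  exact: (cvg_big (@add_continuous _)).
have zero N : \sum_j term j N = 0.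
  transitivity ((\sum_j c j * F j (0 +i* N.+1%:R)) * (expR (2 * pi * e i * N.+1%:R))%:C).
    rewrite mulr_suml; apply: eq_bigr => j _; rewrite /term -!mulrA -[X in _ * (_ * X)]rmorphM /=.
    congr (_ * (_ * _%:C)); rewrite -expRM_natl -expRD.
    by congr expR; ring.
  by rewrite cF mul0r.
have : (\sum_j term j N : C^o) @[N --> \oo] --> (0 : C^o).
  exact: (eq_cvgn zero (cvg_cst (0 : C^o))).
move=> /(cvg_unique (@norm_hausdorff _ _) lim_sum) /eqP.
by rewrite /limit -big_mkcond big_pred1_eq mulf_eq0 (negbTE ci) (negbTE (a0 i)).
Qed.

End QSeries.

(** * The spectrum of T in a congruence representation *)

Section Congruence.

Definition mat2 (a b c d : int) : 'M[int]_2 :=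
  \matrix_(i < 2, j < 2) (if i == 0 then if j == 0 then a else b
                          else if j == 0 then c else d).

Lemma mat2M a b c d a' b' c' d' :
  mat2 a b c d *m mat2 a' b' c' d' =
  mat2 (a * a' + b * c') (a * b' + b * d') (c * a' + d * c') (c * b' + d * d').
Proof.
apply/matrixP => i j; rewrite !mxE !big_ord_recl big_ord0 !mxE addr0 /=.
by case: i => [[|[|i]] hi] //; case: j => [[|[|j]] hj].
Qed.

Lemma mat2_1 : mat2 1 0 0 1 = 1%:M.
Proof.
by apply/matrixP => i j; rewrite !mxE; case: i => [[|[|i]] hi] //; case: j => [[|[|j]] hj].
Qed.

Lemma mat2_SL2Z a b c d : (mat2 a b c d \in SL2Z) = (a * d - b * c == 1).
Proof.
rewrite /SL2Z inE (expand_det_row _ 0) !big_ord_recl big_ord0 /cofactor !det_mx11 !mxE /=.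
by rewrite addr0 expr0 mul1r expr1 mulN1r mulrN.
Qed.

Variables (R : realType) (d : nat) (rho : 'M[int]_2 -> 'M[R[i]]_d).
Variable lambda : 'I_d -> R[i].
Hypothesis rho_rep : is_representation rho.
Hypothesis rho_T : rho (mat2 1 1 0 1) = diag_mx (\row_i lambda i).

Lemma rho_translation (n : nat) :
  rho (mat2 1 n 0 1) = diag_mx (\row_i lambda i ^+ n).
Proof.
have [r1 rM] := rho_rep.
elim: n => [|n IHn].
  rewrite mat2_1 r1; apply/matrixP => i j; rewrite !mxE expr0.
  by case: eqP.
have -> : mat2 1 n.+1 0 1 = mat2 1 1 0 1 *m mat2 1 n 0 1.
  by rewrite mat2M; congr mat2; rewrite ?intS; ring.
rewrite rM ?mat2_SL2Z ?mulr0 ?mulr1 ?subr0 // rho_T IHn mulmx_diag.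
by congr diag_mx; apply/rowP => i; rewrite !mxE exprS.
Qed.

(** For g = ((u, N), (c, x)) with N | c, h = g T g^-1 T^(-u^2) lies in Gamma(N).
    So rho(g) intertwines rho(T) and rho(T)^(u^2), both diagonal, and it has a
    nonzero entry in each row. *)
Lemma congruence_spectrum (N : nat) :
  (forall g, in_principal_congruence N g -> rho g = 1%:M) ->
  forall u : nat, coprime u N -> forall i, exists j, lambda j = lambda i ^+ (u ^ 2).
Proof.
move=> trivN u uN i; have [r1 rM] := rho_rep.
have cop : coprimez u%:Z (N%:Z * N%:Z).
  by rewrite coprimezE abszM coprimeMr uN.
have [[x y] /= xy] := coprimezP _ _ cop.
pose c : int := - (y * N%:Z).
have det1 : u%:Z * x - N%:Z * c = 1 by rewrite -xy /c; ring.
pose g := mat2 u N c x; pose g' := mat2 x (- N%:Z) (- c) u.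
pose h := mat2 (1 - u%:Z * c) (u%:Z ^+ 3 * c) (- c ^+ 2) (1 + u%:Z * c + u%:Z ^+ 2 * c ^+ 2).
have gS : g \in SL2Z by rewrite mat2_SL2Z; apply/eqP.
have g'S : g' \in SL2Z by rewrite mat2_SL2Z; apply/eqP; rewrite -det1; ring.
have gg' : g *m g' = 1%:M.
  by rewrite mat2M -mat2_1; congr mat2; (try rewrite -det1); ring.
have TS (z : int) : mat2 1 z 0 1 \in SL2Z by rewrite mat2_SL2Z mulr0 mulr1 subr0.
have hS : h \in SL2Z by rewrite mat2_SL2Z; apply/eqP; ring.
have hN : in_principal_congruence N h.
  split=> // k l; apply/eqP; rewrite eqz_mod_dvd !mxE.
  have Nc : (N%:Z %| c)%Z by rewrite /c rpredN dvdz_mull.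
  case: k => [[|[|k]] hk] //; case: l => [[|[|l]] hl] //=.
  - by rewrite (_ : _ - _ = - (u%:Z * c)); [rewrite rpredN dvdz_mull | ring].
  - by rewrite subr0 dvdz_mull.
  - by rewrite subr0 rpredN expr2 dvdz_mull.
  - rewrite (_ : _ - _ = (u%:Z + u%:Z ^+ 2 * c) * c); [by rewrite dvdz_mull | ring].
have gT : g *m mat2 1 1 0 1 = h *m (mat2 1 (u ^ 2)%N 0 1 *m g).
  have uE : (u ^ 2)%N%:Z = u%:Z ^+ 2 by rewrite -natz natrX natz.
  rewrite !mat2M uE; congr mat2; [ring | | ring |].
    by transitivity (N%:Z + u%:Z * (u%:Z * x - N%:Z * c)); [rewrite det1 | ]; ring.
  by transitivity (x + c * (u%:Z * x - N%:Z * c)); [rewrite det1 | ]; ring.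
have conj : rho g *m diag_mx (\row_j lambda j) = diag_mx (\row_j lambda j ^+ (u ^ 2)) *m rho g.
  rewrite -rho_T -rho_translation -!rM // gT rM ?(trivN _ hN) ?mul1mx //.
  by rewrite /SL2Z inE det_mulmx (eqP (TS _)) (eqP gS) mulr1.
have [j gij] : exists j, rho g i j != 0.
  apply: contrapT => h0.
  have g0 j : rho g i j = 0 by apply/eqP; apply: contraT => nz; case: h0; exists j.
  have : (rho g *m rho g') i i = 1 by rewrite -rM // gg' r1 mxE eqxx.
  rewrite mxE big1 => [/eqP|j _]; first by rewrite eq_sym oner_eq0.
  by rewrite g0 mul0r.
exists j; move/matrixP: conj => /(_ i j).
rewrite mul_mx_diag mul_diag_mx !mxE mulrC => /mulIf; exact.
Qed.

End Congruence.

(** * The exponents of the 1-point functions *)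

Section Exponents.
Variable R : realType.

Definition exponent_numerator (p q m n : nat) (x : nat * nat) : int :=
  12 * (x.2%:Z * p%:Z - x.1%:Z * q%:Z) ^+ 2 - 2 * p%:Z * q%:Z
  - (n%:Z * p%:Z - m%:Z * q%:Z) ^+ 2 + (p%:Z - q%:Z) ^+ 2.

Lemma exponent_numeratorE (p q m n : nat) (x : nat * nat) : (0 < p)%N -> (0 < q)%N ->
  minimal_weight R p q x.1 x.2 - minimal_charge R p q / 24 - minimal_weight R p q m n / 12
  = (exponent_numerator p q m n x)%:~R / (48 * p * q)%N%:R.
Proof.
move=> p0 q0; have p0' : p%:R != 0 :> R by rewrite pnatr_eq0 -lt0n.
have q0' : q%:R != 0 :> R by rewrite pnatr_eq0 -lt0n.
rewrite /minimal_weight /minimal_charge /exponent_numerator !natrM.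
rewrite !(rmorphB, rmorphD, rmorphM, rmorphXn, rmorphN) /= .
rewrite -!pmulrn.
by field; rewrite p0' q0'.
Qed.

Lemma exponent_numerator_swap (p q m n : nat) (x : nat * nat) :
  exponent_numerator p q m n x = exponent_numerator q p n m (x.2, x.1).
Proof. by rewrite /exponent_numerator /=; ring. Qed.

(** Equal weights mean that the x.2 p - x.1 q agree up to sign; coprimality and the
    bounds on the entries do the rest. *)
Lemma minimal_weight_inj (p q m n : nat) (x y : nat * nat) : coprime p q ->
  admissible p q m n x -> admissible p q m n y ->
  minimal_weight R p q x.1 x.2 = minimal_weight R p q y.1 y.2 ->
  equivalent_triples p q x y.
Proof.
case: x y => [x1 x2] [y1 y2] cop.
case=> /= -[mp /andP[x10 x1p]] [nq /andP[x20 x2q]] _ _ _ /=.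
case=> /= -[_ /andP[y10 y1p]] [_ /andP[y20 y2q]] _ _ _ /=.
have p0 : p%:R != 0 :> R by rewrite pnatr_eq0; lia.
have q0 : q%:R != 0 :> R by rewrite pnatr_eq0; lia.
pose A (z1 z2 : nat) : int := z2%:Z * p%:Z - z1%:Z * q%:Z.
have AE z1 z2 : (A z1 z2)%:~R = z2%:R * p%:R - z1%:R * q%:R :> R.
  by rewrite /A rmorphB !rmorphM /= -!pmulrn.
rewrite /minimal_weight -!AE => /(congr1 ( *%R^~ (4 * p%:R * q%:R))).
have pq0 : 4 * p%:R * q%:R != 0 :> R by rewrite !mulf_neq0.
rewrite !divfK // => /addIr /eqP; rewrite eqf_sqr -rmorphN /= !eqr_int => AA.
have pq : coprimez p%:Z q%:Z by rewrite coprimezE.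
have q_dvd (z : int) : (q%:Z %| z * p%:Z)%Z -> (q%:Z %| z)%Z.
  by rewrite Gauss_dvdzl // coprimez_sym.
have q0' : q%:Z != 0 by lia.
case/orP: AA => /eqP; rewrite /A => e; [left | right].
  have h : (q%:Z %| x2%:Z - y2%:Z)%Z.
    apply: q_dvd; apply/dvdzP; exists (x1%:Z - y1%:Z).
    by rewrite !mulrBl; move: e; lia.
  have x2y2 : x2 = y2.
    have [lt|lt|//] := ltngtP x2 y2; exfalso; move: h; last first.
      by apply/negP/ndvdz_between; lia.
    by rewrite -opprB rpredN; apply/negP/ndvdz_between; lia.
  have e' : x1%:Z * q%:Z = y1%:Z * q%:Z by move: e; rewrite x2y2; lia.
  by have [->] := mulIf q0' e'; rewrite x2y2.
have h : (q%:Z %| x2%:Z + y2%:Z)%Z.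
  apply: q_dvd; apply/dvdzP; exists (x1%:Z + y1%:Z).
  by rewrite !mulrDl; move: e; lia.
have x2y2 : (x2 + y2 = q)%N.
  have [lt|lt|//] := ltngtP (x2 + y2) q; exfalso.
    by move: h; apply/negP/ndvdz_between; lia.
  have : (q%:Z %| x2%:Z + y2%:Z - q%:Z)%Z by rewrite rpredB.
  by apply/negP/ndvdz_between; lia.
have x1y1 : (x1%:Z + y1%:Z) * q%:Z = p%:Z * q%:Z.
  have -> : p%:Z * q%:Z = (x2%:Z + y2%:Z) * p%:Z by rewrite -x2y2 PoszD mulrC.
  by rewrite !mulrDl; move: e; lia.
have x1y1' := mulIf q0' x1y1.
by congr (_, _) => /=; lia.
Qed.

End Exponents.

(** * The matrix of the translation *)

Section TranslationMatrix.
Variable R : realType.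
Local Notation C := R[i].
Local Open Scope complex_scope.
Local Open Scope classical_set_scope.

Lemma cpow1 (k : R) : cpow (1 : C) k = 1.
Proof.
rewrite /cpow /clog /carg normr1 /= lexx divr1 acos1 ln1.
by rewrite (_ : 0 +i* 0 = 0) // mulr0 cexp0.
Qed.

Lemma upper_half_translate (tau : C) : upper_half tau -> upper_half (tau + 1).
Proof. by case: tau => x y; rewrite /upper_half /= addr0. Qed.

Lemma moebius_translation (tau : C) : moebius (mat2 1 1 0 1) tau = tau + 1.
Proof. by rewrite /moebius /automorphy !mxE /= mul1r mul0r add0r divr1. Qed.

Lemma automorphy_translation (tau : C) : automorphy (mat2 1 1 0 1) tau = 1.
Proof. by rewrite /automorphy !mxE /= mul0r add0r. Qed.

Lemma translation_SL2Z : mat2 1 1 0 1 \in SL2Z.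
Proof. by rewrite mat2_SL2Z. Qed.

(** The summands depend on e^{2 pi i tau} only, so no convergence is involved. *)
Lemma log_eta_translate (tau : C) :
  log_eta (tau + 1) = log_eta tau + (pi / 12)%:C * 'i%C.
Proof.
have per : (fun N : nat => \sum_(1 <= n < N) clog (1 - qpow (tau + 1) n%:R) : C^o) =
    (fun N : nat => \sum_(1 <= n < N) clog (1 - qpow tau n%:R) : C^o).
  apply/funext => N; apply: eq_bigr => n _.
  by rewrite qpow_translate (unit_exp_int _ n) mul1r.
by rewrite /log_eta per mulrDr mulr1 addrAC.
Qed.

Lemma eta_multiplier_translation (k : R) (upsilon : 'M[int]_2 -> C) :
  eta_multiplier k upsilon -> upsilon (mat2 1 1 0 1) = unit_exp (k / 12).
Proof.
move=> ups; have up : upper_half ('i : C) by rewrite /upper_half /= ltr01.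
have := ups _ _ translation_SL2Z up.
rewrite moebius_translation automorphy_translation cpow1 mulr1 /eta_pow.
rewrite log_eta_translate mulrDr cexpD mulrC => /(mulIf (cexp_neq0 _)) <-.
have kE : 2 * pi * (k / 12) = (2 * k) * (pi / 12) by ring.
by rewrite /unit_exp kE [in RHS]rmorphM /= mulrA.
Qed.

Lemma one_point_leading (V : voa C) (L M : vmodule V) (Y : intertwiner M L M)
    (c h k : R) (u : L) (F : C -> C) :
  (forall tau, upper_half tau -> one_point_value Y c h k u tau (F tau)) ->
  (F (0 +i* N.+1%:R) * (expR (2 * pi * (h - c / 24) * N.+1%:R))%:C : C^o)
    @[N --> \oo] --> (trace_on (weight_space M h%:C) (zero_mode Y k%:C u) : C^o).
Proof.
move=> hF; rewrite -[in weight_space _ _](addr0 h).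
pose a n := trace_on (weight_space M (h + n%:R)%:C) (zero_mode Y k%:C u).
apply: (@qseries_leading _ a) => tau /hF.
apply: eq_cvgn => K; apply: eq_bigr => n _.
by rewrite addrAC.
Qed.

Lemma one_point_translate (V : voa C) (L M : vmodule V) (Y : intertwiner M L M)
    (c h k : R) (u : L) (F : C -> C) tau :
  (forall tau, upper_half tau -> one_point_value Y c h k u tau (F tau)) ->
  upper_half tau -> F (tau + 1) = unit_exp (h - c / 24) * F tau.
Proof.
move=> hF up; have h1 := hF _ (upper_half_translate up).
have h0 := cvgn_mull (b := unit_exp (h - c / 24)) (hF _ up).
apply: (cvg_unique (@norm_hausdorff _ _) h1).
apply: (eq_cvgn _ h0) => K; rewrite mulr_sumr; apply: eq_bigr => n _.
have -> : h + n%:R - c / 24 = h - c / 24 + n%:R by rewrite addrAC.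
rewrite qpow_translate unit_expD (unit_exp_int _ n) mulr1.
by rewrite mulrCA.
Qed.

Variables (p q m n : nat) (V : voa C) (L : vmodule V).
Variables (d : nat) (rho : 'M[int]_2 -> 'M[C]_d).
Hypotheses (p_gt0 : (0 < p)%N) (q_gt0 : (0 < q)%N) (copq : coprime p q).
Hypotheses (V_min : minimal_model p q V) (L_mn : is_Lmn p q m n L).

Definition translation_eigenvalue (x : nat * nat) : C :=
  unit_exp ((exponent_numerator p q m n x)%:~R / (48 * p * q)%N%:R).

(** Both rho(T) and the diagonal matrix express the S_j(u, tau + 1) through the
    linearly independent S_i(u, tau). *)
Lemma associated_translation : associated_representation p q m n L rho ->
  is_representation rho /\ exists2 t : 'I_d -> nat * nat, complete_list p q m n t &
    rho (mat2 1 1 0 1) = diag_mx (\row_j translation_eigenvalue (t j)).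
Proof.
case=> t [M [Y [u [F [upsilon]]]]] [t_list M_mn Y_neq0 u_hwv [hF ups rho_rep rhoF]].
split=> //; exists t => //; set k := minimal_weight R p q m n in hF ups rhoF u_hwv.
set c := minimal_charge R p q in hF.
pose h j := minimal_weight R p q (t j).1 (t j).2.
have V_gen : virasoro_generated V by case: V_min.
have lead j : trace_on (weight_space (M j) (h j)%:C) (zero_mode (Y j) k%:C u) != 0.
  apply: (top_trace_neq0 V_gen) => //; first by case: L_mn.
  - by case: (M_mn j).
  - by case: (M_mn j).
have e_inj : injective (fun j => h j - c / 24).
  have [adm ineq _] := t_list.
  by move=> i j /addIr /(minimal_weight_inj copq (adm i) (adm j)) /ineq.
have FT j tau : upper_half tau ->
    \sum_i rho (mat2 1 1 0 1) j i * F i tau = translation_eigenvalue (t j) * F j tau.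
  move=> up; rewrite -(rhoF _ _ _ translation_SL2Z up) /slash.
  rewrite automorphy_translation cpow1 mulr1 moebius_translation.
  rewrite (one_point_translate (hF j) up) (eta_multiplier_translation ups).
  rewrite mulrA -unit_expN -unit_expD /translation_eigenvalue -exponent_numeratorE //.
  by rewrite addrC.
apply/matrixP => j i; apply/eqP; rewrite -subr_eq0; apply/eqP.
move: i; apply: (leading_exponents_independent e_inj lead).
  by move=> i; apply: one_point_leading (hF i).
move=> N; have up : upper_half (0 +i* N.+1%:R : C) by rewrite /upper_half /= ltr0n.
under eq_bigr do rewrite mulrBl.
rewrite sumrB FT // (bigD1 j) //= big1 ?addr0.
  by rewrite !mxE eqxx mulr1n subrr.
by move=> i ij; rewrite !mxE eq_sym (negbTE ij) mulr0n mul0r.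
Qed.

End TranslationMatrix.

(** * Noncongruence *)

Section SpectrumArithmetic.
Variable R : realType.

Lemma translation_eigenvalue_power (p q m n U : nat) (x y : nat * nat) :
  (0 < p)%N -> (0 < q)%N ->
  translation_eigenvalue R p q m n x = translation_eigenvalue R p q m n y ^+ U ->
  ((48 * p * q)%N%:Z %| U%:Z * exponent_numerator p q m n y - exponent_numerator p q m n x)%Z.
Proof.
move=> p0 q0; rewrite /translation_eigenvalue.
set X := exponent_numerator _ _ _ _ _; set Y := exponent_numerator _ _ _ _ _.
set D := (48 * p * q)%N => e.
have D0 : D%:R != 0 :> R by rewrite pnatr_eq0 /D; lia.
have : unit_exp (U%:R * (Y%:~R / D%:R) - X%:~R / D%:R : R) = 1.
  by rewrite unit_expD unit_expN e -unit_expX mulfV // expf_neq0 // cexp_neq0.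
move=> /unit_exp_eq1[z hz]; apply/dvdzP; exists z.
apply/eqP; rewrite -(eqr_int R) rmorphB [X in X - _]rmorphM [X in _ == X]rmorphM /= -hz -!pmulrn.
by apply/eqP; field.
Qed.

End SpectrumArithmetic.

Lemma exponent_numerator_equiv (p q m n : nat) (x : nat * nat) :
  (x.1 <= p)%N -> (x.2 <= q)%N ->
  exponent_numerator p q m n ((p - x.1)%N, (q - x.2)%N) = exponent_numerator p q m n x.
Proof.
by move=> x1p x2q; rewrite /exponent_numerator /= -!subzn //; ring.
Qed.

Lemma exponent_numerator_dvd (p q m n : nat) (U : int) (x y : nat * nat) : coprime p q ->
  (p%:Z %| U * exponent_numerator p q m n y - exponent_numerator p q m n x)%Z ->
  (p%:Z %| U * qform m y.1%:Z - qform m x.1%:Z)%Z.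
Proof.
move=> cop; pose rest (z : nat * nat) : int :=
  12 * z.2%:Z ^+ 2 * p%:Z - 24 * z.2%:Z * z.1%:Z * q%:Z - 4 * q%:Z
  - n%:Z ^+ 2 * p%:Z + 2 * n%:Z * m%:Z * q%:Z + p%:Z.
have XE z : exponent_numerator p q m n z = q%:Z ^+ 2 * qform m z.1%:Z + rest z * p%:Z.
  by rewrite /exponent_numerator /qform /rest; ring.
rewrite !XE => h.
have : (p%:Z %| q%:Z ^+ 2 * (U * qform m y.1%:Z - qform m x.1%:Z))%Z.
  rewrite (_ : _ * _ = U * (q%:Z ^+ 2 * qform m y.1%:Z + rest y * p%:Z) -
    (q%:Z ^+ 2 * qform m x.1%:Z + rest x * p%:Z) - (U * rest y - rest x) * p%:Z); last by ring.
  by rewrite rpredB // dvdz_mull.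
by rewrite Gauss_dvdzr // coprimezE abszX coprimeXr.
Qed.

Lemma admissible_swap (p q m n : nat) (x : nat * nat) :
  admissible p q m n x -> admissible q p n m (x.2, x.1).
Proof. by case=> -[? ?] [? ?] [? ?] [? ?] [? ?]; split. Qed.

(** Every j in the range is the first entry of an admissible pair, whose second
    entry can be (n + 1)/2. *)
Lemma no_square_closed_spectrum (r a p q m n N : nat) :
  prime r -> (3 < r)%N -> (0 < a)%N -> p = (r ^ a)%N -> coprime p q ->
  odd m -> odd n -> (3 <= m)%N -> (m + 4 <= p)%N -> (n + 4 <= q)%N -> (0 < N)%N ->
  ~ (forall u : nat, coprime u N -> forall x, admissible p q m n x ->
      exists2 y, admissible p q m n y &
        (p%:Z %| u%:Z ^+ 2 * exponent_numerator p q m n x - exponent_numerator p q m n y)%Z).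
Proof.
move=> pr r3 a0 pE cop om on m3 mp nq N0 H.
apply: (no_square_closed_range pr r3 om pE m3 mp a0 N0) => u j uN [jl ju].
have adm : admissible p q m n (j, n.+1./2).
  by split=> /=; split; lia.
have [y [_ _ [y1 _] [y2 _] _] /(exponent_numerator_dvd cop) h] := H u uN _ adm.
by exists y.1.
Qed.

Theorem theorem3p17 (R : realType) (r s a b p q m n : nat) (alpha beta : int)
    (r_prime : prime r) (s_prime : prime s) (neq_rs : r <> s)
    (r_gt3 : (3 < r)%N) (s_gt3 : (3 < s)%N)
    (a_ge1 : (1 <= a)%N) (b_ge1 : (1 <= b)%N)
    (def_p : p = (r ^ a)%N) (def_q : q = (s ^ b)%N)
    (def_alpha : alpha = Num.ceil ((r%:R : rat) ^ (a%:Z - 2)))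
    (def_beta : beta = Num.ceil ((s%:R : rat) ^ (b%:Z - 2)))
    (m_odd : odd m) (n_odd : odd n)
    (m_bounds : (1 <= m <= p - 1)%N) (n_bounds : (1 <= n <= q - 1)%N)
    (V : voa R[i]) (V_min : minimal_model p q V)
    (L : vmodule V) (L_mn : is_Lmn p q m n L)
    (d : nat) (rho : 'M[int]_2 -> 'M[R[i]]_d)
    (rho_mn : associated_representation p q m n L rho)
    (m_ineq : alpha <= m%:Z <= p%:Z - 4)
    (n_ineq : beta <= n%:Z <= q%:Z - 4)
    (strict : alpha < m%:Z \/ beta < n%:Z) :
  noncongruence rho.
Proof.
case=> N N1 trivN.
have p0 : (0 < p)%N by lia.
have q0 : (0 < q)%N by lia.
have cop : coprime p q.
  rewrite def_p def_q; apply/coprimeXl/coprimeXr.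
  by rewrite prime_coprime // dvdn_prime2 //; apply/eqP.
have [rho_rep [t [t_adm _ t_complete] rho_T]] :=
  associated_translation p0 q0 cop V_min L_mn rho_mn.
have closed u : coprime u N -> forall x, admissible p q m n x ->
    exists2 y, admissible p q m n y & ((48 * p * q)%N%:Z %|
      u%:Z ^+ 2 * exponent_numerator p q m n x - exponent_numerator p q m n y)%Z.
  move=> uN x /t_complete[i ix].
  have [j ji] := congruence_spectrum rho_rep rho_T trivN uN i.
  exists (t j) => //.
  have -> : exponent_numerator p q m n x = exponent_numerator p q m n (t i).
    have [[_ /andP[_ /ltnW i1]] [_ /andP[_ /ltnW i2]] _ _ _] := t_adm i.
    by case: ix => ->; rewrite ?exponent_numerator_equiv.
  rewrite (_ : u%:Z ^+ 2 = (u ^ 2)%N%:Z); last by rewrite -mulnn PoszM.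
  exact: (translation_eigenvalue_power p0 q0 ji).
have ceil_pos (l c : nat) : (3 < l)%N -> 0 < Num.ceil ((l%:R : rat) ^ (c%:Z - 2)).
  by move=> l3; rewrite ceil_gt0 exprz_gt0 // ltr0n (ltn_trans _ l3).
case: strict => strict.
- have alpha0 : 0 < alpha by rewrite def_alpha ceil_pos.
  apply: (no_square_closed_spectrum r_prime r_gt3 a_ge1 def_p cop m_odd n_odd _ _ _ N1); try lia.
  move=> u uN x adm; have [y y_adm /dvdzP[k hk]] := closed u uN x adm.
  exists y => //; rewrite hk.
  by rewrite !PoszM mulrA mulrAC mulrA dvdz_mull.
- have beta0 : 0 < beta by rewrite def_beta ceil_pos.
  rewrite coprime_sym in cop.
  apply: (no_square_closed_spectrum s_prime s_gt3 b_ge1 def_q cop n_odd m_odd _ _ _ N1); try lia.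
  move=> u uN x adm; have [y y_adm /dvdzP[k hk]] := closed u uN _ (admissible_swap adm).
  exists (y.2, y.1); first exact: admissible_swap.
  rewrite (exponent_numerator_swap q) (exponent_numerator_swap q p n m (_, _)) /= -surjective_pairing hk.
  by rewrite !PoszM mulrA dvdz_mull.
Qed.
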